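(* Let $W$ be an irreducible finite Weyl group with irreducible reflection representation $V$, $n=\dim V$, and let $M$ be a finite-dimensional $\mathbb{C}W$-module. Let $\chi$ be a simple module of the Hecke-Clifford superalgebra $\mathfrak{H}^{\mathfrak c}_W=\mathcal{C}l_V\rtimes W$, and $\chi^-$ the simple $\mathbb{C}W^-$-module corresponding to $\chi$ under the Morita super-equivalence. Put $$m_\chi=\dim\mathrm{Hom}_{\mathfrak{H}^{\mathfrak c}_W}(\chi,\ \mathcal{C}l_V\otimes M),\qquad m_\chi^-=\dim\mathrm{Hom}_{\mathbb{C}W^-}(\chi^-,\ \mathcal{B}_W\otimes M).$$ Then $$m_\chi^-=\begin{cases} m_\chi & \text{if } n \text{ is even}, \\ 2 m_\chi & \text{if } n \text{ is odd and } \chi \text{ is of type } \mathtt{M}, \\ m_\chi & \text{if } n \text{ is odd and } \chi \text{ is of type } \mathtt{Q}. \end{cases}$$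
   Context: All algebras and modules are finite-dimensional over $\mathbb{C}$. Modules over a superalgebra $A$ are $\mathbb{Z}_2$-graded, simple means no proper nonzero graded submodule, $\mathrm{Hom}_A(M,N)$ is spanned by all homogeneous (even and odd) linear maps $f$ with $f(am)=(-1)^{|f||a|}af(m)$; isomorphisms may be even or odd. A simple $M$ is of type $\mathtt{M}$ if $\dim\mathrm{Hom}_A(M,M)=1$ and of type $\mathtt{Q}$ if this dimension is $2$. Let $W=\langle s_1,\dots,s_n\mid (s_is_j)^{m_{ij}}=1\rangle$ be the Coxeter presentation. $\mathbb{C}W^-$ is generated by odd $t_1,\dots,t_n$ with relations $(t_it_j)^{m_{ij}}=(-1)^{m_{ij}+1}$. $\mathcal{C}l_V$ is the Clifford superalgebra of $V$ with its $W$-invariant nondegenerate symmetric form ($vw+wv=2(v,w)$), and $\beta_i\in\mathcal{C}l_V$ corresponds to the simple root $\alpha_i$ normalized by $\beta_i^2=1$. $W$ acts on $\mathcal{C}l_V$ by automorphisms; in $\mathfrak{H}^{\mathfrak c}_W=\mathcal{C}l_V\rtimes W$ elements of $W$ are even. $U$ is the unique simple $\mathcal{C}l_V$-module, and $\mathcal{B}_W$ is its pullback via $\mathbb{C}W^-\to\mathcal{C}l_V$, $t_i\mapsto\beta_i$. For a $W$-module $M$: $\mathcal{B}_W\otimes M$ is a $\mathbb{C}W^-$-module via $t_i(u\otimes x)=(t_iu)\otimes(s_ix)$, and $\mathcal{C}l_V\otimes M$ is an $\mathfrak{H}^{\mathfrak c}_W$-module with $\mathcal{C}l_V$ acting by left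 multiplication on the first factor and $W$ acting diagonally. There is a superalgebra isomorphism $\mathfrak{H}^{\mathfrak c}_W\cong\mathcal{C}l_V\otimes\mathbb{C}W^-$, identity on $\mathcal{C}l_V$, $s_i\mapsto-\sqrt{-1}\,\beta_it_i$. It gives functors $\mathfrak{F}=U\otimes-:\mathbb{C}W^-\text{-mod}\to\mathfrak{H}^{\mathfrak c}_W\text{-mod}$ and $\mathfrak{G}=\mathrm{Hom}_{\mathcal{C}l_V}(U,-)$ in the other direction. They induce a bijection $\chi\leftrightarrow\chi^-$ between isoclasses of simple modules: for $n$ even, they are mutually inverse equivalences and $\chi^-=\mathfrak{G}(\chi)$, of the same type; for $n$ odd, $\mathfrak{F}\mathfrak{G}\cong\mathrm{id}\oplus\Pi$ and $\mathfrak{G}\mathfrak{F}\cong\mathrm{id}\oplus\Pi$ ($\Pi$ the parity shift), and if $\chi$ is of type $\mathtt{M}$ then $\chi^-=\mathfrak{G}(\chi)$ is of type $\mathtt{Q}$, while if $\chi$ is of type $\mathtt{Q}$ then $\chi^-$ is the type $\mathtt{M}$ simple module with $\mathfrak{F}(\chi^-)\cong\chi$. *)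

(* Defs.v *)
From HB Require Import structures.
From mathcomp Require Import all_boot all_order all_fingroup all_algebra.
From mathcomp Require Import all_field all_character.
From mathcomp Require Import complex.
From mathcomp Require Import boolp reals.

Set Implicit Arguments.
Unset Strict Implicit.
Unset Printing Implicit Defensive.

Import Order.TTheory GRing.Theory Num.Theory.
Local Open Scope ring_scope.

Section Span.
Variables (F : fieldType) (vT : vectType F).
Implicit Types P : vT -> Prop.

Lemma vspan_subproof P :
  exists U : {vspace vT},
    (exists2 s : seq vT, (forall x, x \in s -> P x) & U = <<s>>%VS) /\
    (forall x, P x -> x \in U).
Proof.
suff H k (s : seq vT) : (forall x, x \in s -> P x) ->
    (\dim {:vT} - \dim <<s>> <= k)%N -> exists U : {vspace vT},
    (exists2 s : seq vT, (forall x, x \in s -> P x) & U = <<s>>%VS) /\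
    (forall x, P x -> x \in U).
  exact: (H (\dim {:vT} - \dim (<<[::]>> : {vspace vT}))%N [::]).
elim: k s => [|k IH] s Ps ds.
  exists <<s>>%VS; split; first by exists s.
  move=> x _; suff -> : <<s>>%VS = fullv by rewrite memvf.
  by apply/eqP; rewrite eqEdim subvf /= -subn_eq0 -leqn0.
have [h|/existsNP[x /not_implyP[Px xs]]] :=
  pselect (forall x, P x -> x \in <<s>>%VS).
  by exists <<s>>%VS; split => //; exists s.
apply: (IH (x :: s)).
  by move=> y; rewrite inE => /orP[/eqP -> //|]; apply: Ps.
have lt : (\dim <<s>> < \dim <<x :: s>>)%N.
  rewrite ltnNge; apply/negP => le.
  have /eqP e : <<s>>%VS == <<x :: s>>%VS.
    by rewrite eqEdim le andbT; apply: sub_span => y ys; rewrite inE ys orbT.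
  by apply: xs; rewrite e memv_span // mem_head.
by rewrite leq_subLR; move: ds; rewrite leq_subLR => /leq_trans; apply;
  rewrite -addSnnS leq_add2r.
Qed.

Definition vspan P : {vspace vT} := sval (cid (vspan_subproof P)).

Lemma mem_vspan P x : P x -> x \in vspan P.
Proof. by rewrite /vspan; case: cid => U /= [_]; apply. Qed.

Lemma vspanP P v : v \in vspan P <->
  exists2 s : seq vT, (forall x, x \in s -> P x) & v \in <<s>>%VS.
Proof.
split=> [|[s Ps]]; first by rewrite /vspan; case: cid => U /= [[s Ps ->] _]; exists s.
by apply/subvP/span_subvP => x /Ps/mem_vspan.
Qed.

End Span.

(** [U (x) M] is modelled as [U ^ (dim M)]: the j-th component of a tensor is
    its coefficient on the j-th vector of the chosen basis of [M]. Lemma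
    [tensor_universal] is the universal property. *)
Definition tensor (F : fieldType) (U M : vectType F) : vectType F :=
  {ffun 'I_(\dim {:M}) -> U}.

Definition tens (F : fieldType) (U M : vectType F) (u : U) (x : M) :
  tensor U M := [ffun j => coord (vbasis {:M}) j x *: u].

Section Tensor.
Variables (F : fieldType) (U M V : vectType F).

Lemma tens_linearl (x : M) : linear (fun u : U => tens u x).
Proof.
move=> a u v; apply/ffunP => j; rewrite !ffunE.
by rewrite scalerDr !scalerA mulrC.
Qed.

Lemma tens_linearr (u : U) : linear (fun x : M => tens u x).
Proof.
move=> a x y; apply/ffunP => j; rewrite !ffunE.
by rewrite linearP scalerDl scalerA.
Qed.

Lemma tens_basis (z : tensor U M) :
  z = \sum_j tens (z j) (vbasis {:M})`_j.
Proof.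
apply/ffunP => k; rewrite sum_ffunE (bigD1 k) //= big1 ?addr0 => [|j jk].
  by rewrite ffunE coord_free ?(basis_free (vbasisP _)) // eqxx scale1r.
by rewrite ffunE coord_free ?(basis_free (vbasisP _)) // (negPf jk) scale0r.
Qed.

Lemma tensor_universal (b : U -> M -> V) :
  (forall x, linear (fun u => b u x)) -> (forall u, linear (b u)) ->
  exists! f : 'Hom(tensor U M, V), forall u x, f (tens u x) = b u x.
Proof.
move=> bl br.
pose g (z : tensor U M) := \sum_j b (z j) (vbasis {:M})`_j.
have gl : linear g.
  move=> a y z; rewrite /g scaler_sumr -big_split /=; apply: eq_bigr => j _.
  by rewrite !ffunE bl.
pose gL := GRing.isLinear.Build _ _ _ _ g gl.
pose gl' : {linear tensor U M -> V} := HB.pack g gL.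
have brs u (I : Type) (r : seq I) (c : I -> F) (e : I -> M) :
    b u (\sum_(i <- r) c i *: e i) = \sum_(i <- r) c i *: b u (e i).
  have b0 : b u 0 = 0.
    by have := br u (-1) 0 0; rewrite scaler0 addr0 scaleN1r addNr.
  by elim/big_rec2: _ => [|i y1 y2 _ <-]; rewrite ?b0 ?br.
have blZ a u x : b (a *: u) x = a *: b u x.
  have b0 : b 0 x = 0.
    by have := bl x (-1) 0 0; rewrite scaler0 addr0 scaleN1r addNr.
  by rewrite -[a *: u]addr0 bl b0 addr0.
have gE u x : linfun gl' (tens u x) = b u x.
  rewrite lfunE /= /g; under eq_bigr do rewrite ffunE blZ.
  by rewrite -brs -coord_vbasis ?memvf.
exists (linfun gl'); split=> // f fE; apply/lfunP => z.
rewrite (tens_basis z) !linear_sum; apply: eq_bigr => j _.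
exact: etrans (gE _ _) (esym (fE _ _)).
Qed.

End Tensor.

Definition tensorv (F : fieldType) (U M : vectType F)
    (A : {vspace U}) (B : {vspace M}) : {vspace tensor U M} :=
  vspan (fun z => exists2 u, u \in A & exists2 x, x \in B & z = tens u x).

(** Parities are booleans: [false] is even, [true] is odd. *)

Record superalgebra (F : fieldType) := Superalgebra {
  salg :> falgType F;
  spar : bool -> {vspace salg};
  spar_add : (spar false + spar true = fullv)%VS;
  spar_cap : (spar false :&: spar true = 0)%VS;
  spar1 : 1 \in spar false;
  sparM : forall p q a b,
    a \in spar p -> b \in spar q -> a * b \in spar (p (+) q) }.

Record salg_hom (F : fieldType) (A B : superalgebra F) := SalgHom {
  shf :> {lrmorphism A -> B};
  shf_par : forall p a, a \in spar A p -> shf a \in spar B p }.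

Record supermodule (F : fieldType) (A : superalgebra F) (M : vectType F) :=
  Supermodule {
  mpar : bool -> {vspace M};
  mact :> {linear A -> 'End(M)};
  mpar_add : (mpar false + mpar true = fullv)%VS;
  mpar_cap : (mpar false :&: mpar true = 0)%VS;
  mact1 : forall m, mact 1 m = m;
  mactM : forall a b m, mact (a * b) m = mact a (mact b m);
  mact_par : forall p q a m,
    a \in spar A p -> m \in mpar q -> mact a m \in mpar (p (+) q) }.

Section Pullback.
Variables (F : fieldType) (A B : superalgebra F) (f : salg_hom A B).
Variables (M : vectType F) (X : supermodule B M).

Let act : {linear A -> 'End(M)} := mact X \o f.

Let act1 m : act 1 m = m.
Proof. by rewrite /act /= rmorph1 mact1. Qed.

Let actM a b m : act (a * b) m = act a (act b m).
Proof. by rewrite /act /= rmorphM mactM. Qed.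

Let act_par p q a m :
  a \in spar A p -> m \in mpar X q -> act a m \in mpar X (p (+) q).
Proof. by move=> /(shf_par f); apply: mact_par. Qed.

Definition pullback : supermodule A M :=
  Supermodule (mpar_add X) (mpar_cap X) act1 actM act_par.

End Pullback.

Section Hom.
Variables (F : fieldType) (A : superalgebra F) (M N : vectType F).
Variables (X : supermodule A M) (Y : supermodule A N).

Definition shom_homog (p : bool) (f : 'Hom(M, N)) : Prop :=
  (forall q m, m \in mpar X q -> f m \in mpar Y (p (+) q)) /\
  (forall q a, a \in spar A q ->
     forall m, f (X a m) = (-1) ^+ (p && q) *: Y a (f m)).

Definition shom : {vspace 'Hom(M, N)} :=
  vspan (fun f => exists p, shom_homog p f).

Definition siso : Prop :=
  exists2 f : 'Hom(M, N), (exists p, shom_homog p f) & bijective f.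

End Hom.

Section Simple.
Variables (F : fieldType) (A : superalgebra F) (M : vectType F).
Variable X : supermodule A M.

Definition is_submodule (S : {vspace M}) : Prop :=
  (forall a m, m \in S -> X a m \in S) /\
  S = (S :&: mpar X false + S :&: mpar X true)%VS.

Definition simple_smod : Prop :=
  \dim {:M} <> 0%N /\
  forall S, is_submodule S -> S = 0%VS \/ S = fullv.

Definition type_M : Prop := simple_smod /\ \dim (shom X X) = 1%N.
Definition type_Q : Prop := simple_smod /\ \dim (shom X X) = 2%N.

End Simple.

(** [T] is the super tensor product of [A] and [B], via [l a * r b <-> a (x) b]. *)
Definition is_super_tensor (F : fieldType) (A B T : superalgebra F)
    (l : salg_hom A T) (r : salg_hom B T) : Prop :=
  (forall p q a b, a \in spar A p -> b \in spar B q ->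
     r b * l a = (-1) ^+ (p && q) *: (l a * r b)) /\
  (exists2 f : 'Hom(tensor A B, T),
     (forall a b, f (tens a b) = l a * r b) & bijective f).

Section Functors.
Variables (F : fieldType) (A B T : superalgebra F).
Variables (l : salg_hom A T) (r : salg_hom B T).
Variables (U : vectType F) (mU : supermodule A U).

(** [Z] is the outer tensor product of [mU] and [Y], with the Koszul sign
    [(a (x) b)(u (x) y) = (-1)^(|b||u|) a u (x) b y]. *)
Definition is_frakF (N : vectType F) (Y : supermodule B N)
    (Z : supermodule T (tensor U N)) : Prop :=
  [/\ forall p, mpar Z p =
        (tensorv (mpar mU false) (mpar Y p) +
         tensorv (mpar mU true) (mpar Y (~~ p)))%VS,
      forall a u y, Z (l a) (tens u y) = tens (mU a u) y &
      forall p q b u y, b \in spar B q -> u \in mpar mU p ->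
        Z (r b) (tens u y) = (-1) ^+ (q && p) *: tens u (Y b y)].

(** [Z] is [Hom_A(U, X)], on which [B] acts by [(b f)(u) = b (f u)]. *)
Definition is_frakG (N : vectType F) (X : supermodule T N)
    (Z : supermodule B (subvs_of (shom mU (pullback l X)))) : Prop :=
  (forall p f,
     f \in mpar Z p <-> shom_homog mU (pullback l X) p (vsval f)) /\
  (forall b f u, vsval (Z b f) u = X (r b) (vsval f u)).

End Functors.

(** [n] is the dimension of the space whose Clifford superalgebra is [A]; its
    parity decides which functor relates [chi] and [chim]. *)
Definition morita_corresponds (F : fieldType) (n : nat)
    (A B T : superalgebra F) (l : salg_hom A T) (r : salg_hom B T)
    (U : vectType F) (mU : supermodule A U)
    (N : vectType F) (chi : supermodule T N)
    (N' : vectType F) (chim : supermodule B N') : Prop :=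
  [/\ simple_smod chim,
      ~~ odd n \/ type_M chi ->
        exists2 Z, is_frakG (l := l) r (mU := mU) (X := chi) Z & siso chim Z &
      odd n -> type_Q chi ->
        type_M chim /\ exists2 Z, is_frakF l r mU chim Z & siso Z chi].

Definition dot (F : fieldType) (n : nat) (u v : 'cV[F]_n) : F :=
  (u^T *m v) 0 0.

Definition is_clifford (F : fieldType) (V : vectType F) (form : V -> V -> F)
    (Cl : superalgebra F) (iota : {linear V -> Cl}) : Prop :=
  [/\ forall v, iota v \in spar Cl true,
      forall v w, iota v * iota w + iota w * iota v = (2 * form v w)%:A,
      agenv (limg (linfun iota)) = fullv &
      forall (B : algType F) (g : {linear V -> B}),
        (forall v w, g v * g w + g w * g v = (2 * form v w)%:A) ->
        exists f : {lrmorphism Cl -> B}, forall v, f (iota v) = g v].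

Definition spin_relations (n : nat) (m : 'I_n -> 'I_n -> nat)
    (B : pzRingType) (b : 'I_n -> B) : Prop :=
  forall i j, (b i * b j) ^+ m i j = (-1) ^+ (m i j).+1.

Definition is_spin_algebra (F : fieldType) (n : nat) (m : 'I_n -> 'I_n -> nat)
    (A : superalgebra F) (t : 'I_n -> A) : Prop :=
  [/\ forall i, t i \in spar A true,
      spin_relations m t,
      agenv <<[seq t i | i : 'I_n]>>%VS = fullv &
      forall (B : algType F) (b : 'I_n -> B), spin_relations m b ->
        exists f : {lrmorphism A -> B}, forall i, f (t i) = b i].

(** The last clause says that [H] is [A (x) F W] as a vector space. *)
Definition is_smash (F : fieldType) (W : finGroupType) (A H : superalgebra F)
    (act : W -> salg_hom A A) (j : salg_hom A H) (k : W -> H) : Prop :=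
  [/\ k 1%g = 1 /\ {morph k : x y / (x * y)%g >-> x * y},
      forall w, k w \in spar H false,
      forall w a, k w * j a = j (act w a) * k w &
      forall h : H, exists! x : {ffun W -> A}, h = \sum_w j (x w) * k w].

(** The Euclidean space is [R^n] with its standard inner product; groups act
    on column vectors on the left. *)

Definition reflection (R : rcfType) (n : nat) (a v : 'cV[R]_n) : 'cV[R]_n :=
  v - (2 * dot a v / dot a a) *: a.

Definition root_system (R : rcfType) (n : nat) (Phi : seq 'cV[R]_n) : Prop :=
  [/\ 0 \notin Phi /\ <<Phi>>%VS = fullv,
      forall a b, a \in Phi -> b \in Phi -> reflection a b \in Phi,
      forall a b, a \in Phi -> b \in Phi ->
        exists z : int, 2 * dot a b / dot a a = z%:~R &
      forall a c, a \in Phi -> c *: a \in Phi -> c = 1 \/ c = -1].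

Definition irreducible_roots (R : rcfType) (n : nat) (Phi : seq 'cV[R]_n) :
    Prop :=
  Phi <> [::] /\
  forall P : pred 'cV[R]_n,
    (forall a b, a \in Phi -> b \in Phi -> P a -> ~~ P b -> dot a b = 0) ->
    all P Phi \/ all (predC P) Phi.

Definition simple_roots (R : rcfType) (n : nat) (Phi : seq 'cV[R]_n)
    (alpha : 'I_n -> 'cV[R]_n) : Prop :=
  [/\ forall i, alpha i \in Phi,
      basis_of fullv [seq alpha i | i : 'I_n] &
      forall a, a \in Phi -> exists c : 'I_n -> nat,
        a = \sum_i (c i)%:R *: alpha i \/ a = - \sum_i (c i)%:R *: alpha i].

Definition weyl_group (R : rcfType) (n : nat) (alpha : 'I_n -> 'cV[R]_n)
    (W : finGroupType) (s : 'I_n -> W)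
    (rV : mx_representation R [set: W] n) : Prop :=
  [/\ <<[set s i | i : 'I_n]>>%g = [set: W],
      mx_faithful rV &
      forall i v, rV (s i) *m v = reflection (alpha i) v].

Definition irreducible_rep (F : fieldType) (W : finGroupType) (n : nat)
    (rV : mx_representation F [set: W] n) : Prop :=
  (0 < n)%N /\
  forall S : {vspace 'cV[F]_n},
    (forall w v, v \in S -> rV w *m v \in S) -> S = 0%VS \/ S = fullv.

Definition coxeter_mx (n : nat) (W : finGroupType) (s : 'I_n -> W)
    (i j : 'I_n) : nat := #[s i * s j]%g.

Definition complexify (R : rcfType) (n : nat) (v : 'cV[R]_n) : 'cV[R[i]]_n :=
  map_mx (real_complex R) v.

Definition complex_repr (R : rcfType) (W : finGroupType) (n : nat)
    (rV : mx_representation R [set: W] n) :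
    mx_representation R[i] [set: W] n := map_repr (real_complex R) rV.

(** Rescaling to a unit vector makes [beta_i ^ 2 = 1]; the positive square root
    fixes the signs coherently. *)
Definition beta (R : rcfType) (n : nat) (alpha : 'I_n -> 'cV[R]_n)
    (Cl : superalgebra R[i]) (iota : 'cV[R[i]]_n -> Cl) (i : 'I_n) : Cl :=
  iota (complexify ((Num.sqrt (dot (alpha i) (alpha i)))^-1 *: alpha i)).

(** [M] is purely even; the formula on generators determines the action. *)
Definition is_spin_tensor (F : fieldType) (n : nat) (W : finGroupType)
    (s : 'I_n -> W) (A : superalgebra F) (t : 'I_n -> A)
    (U : vectType F) (B : supermodule A U)
    (d : nat) (rM : mx_representation F [set: W] d)
    (Z : supermodule A (tensor U 'cV[F]_d)) : Prop :=
  (forall p, mpar Z p = tensorv (mpar B p) fullv) /\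
  (forall i u x, Z (t i) (tens u x) = tens (B (t i) u) (rM (s i) *m x)).

Definition is_clifford_tensor (F : fieldType) (W : finGroupType)
    (Cl H : superalgebra F) (act : W -> salg_hom Cl Cl)
    (j : salg_hom Cl H) (k : W -> H)
    (d : nat) (rM : mx_representation F [set: W] d)
    (Z : supermodule H (tensor Cl 'cV[F]_d)) : Prop :=
  [/\ forall p, mpar Z p = tensorv (spar Cl p) fullv,
      forall c a x, Z (j c) (tens a x) = tens (c * a) x &
      forall w a x, Z (k w) (tens a x) = tens (act w a) (rM w *m x)].

(* Main.v *)
Require Import Defs.
From HB Require Import structures.
From mathcomp Require Import all_boot all_order all_fingroup all_algebra.
From mathcomp Require Import all_field all_character.
From mathcomp Require Import complex.
From mathcomp Require Import reals.

Set Implicit Arguments.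
Unset Strict Implicit.
Unset Printing Implicit Defensive.

Import Order.TTheory GRing.Theory Num.Theory.
Local Open Scope ring_scope.

(** The proof compares dimensions. Call a linear map between supermodules an
    ordinary homomorphism when it commutes with the action without signs.
    Composing odd homomorphisms with the parity operator sigma removes their
    signs, so the spaces of super and of ordinary homomorphisms have the same
    dimension ([dim_shom]). Let e_1, ..., e_n be an orthonormal basis of V in
    the Clifford algebra, let T_i be the action of t_i on a module, let
    N = 2^n, u = dim U, and let h(Y, Z) be the dimension of the space of linear
    maps Y -> Z that commute with all T_i. The superalgebra H^c is generated by
    the e_k and the t_i, which anticommute with each other.

    Halving ([dim_halving]). The involutions f |-> e_k f e_k of Hom(X, Z)
    commute, their common fixed points are the maps that commute with all e_k,
    and f |-> e_k sigma f exchanges the two eigenspaces of the k-th involution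
    while preserving those of the others. So each condition of commuting with
    some e_k divides the dimension by exactly 2. Hence
      N dim Hom_H(X, Z) = h(X, Z)                 [dim_uhom_hecke_clifford]
      N dim Hom_Cl(X, Z) = dim X dim Z            [dim_clifford_hom]
      N h(Hom_Cl(U, X), Z) = u h(X, Z)            [dim_intertw_clifford_hom]
    where the last line applies halving to maps out of Hom(U, X), a sum of u
    copies of X. The second line with X = Z = Cl gives dim Cl = N, and with
    X = Z = U it gives u^2 = N c for c = dim Hom_Cl(U, U). Since c is 1 or 2 by
    Schur's lemma, the parity of the exponents of 2 forces c = 1 for n even and
    c = 2 for n odd ([dim_simple_clifford]).

    Swapping ([clifford_swap]). On Cl (x) M the operator T_i is
    R(beta_i) (x) s_i with R(v) a = sqrt(-1) (-1)^|a| a v, and on B (x) M it is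
    beta_i (x) s_i. On U (x) Cl the product over k of the operators
    e_k (x) 1 + eps (sigma (x) R(e_k)), for a suitable sign eps, conjugates
    e_k (x) 1 into sigma (x) R(e_k), and an involution that applies sigma to the
    second factor when the first one is odd turns the latter into 1 (x) R(e_k)
    ([koszul_untwist]). Therefore N h(Y, B (x) M) = u h(Y, Cl (x) M) for every Y
    ([dim_intertw_spin_tensor]). The same untwisting shows that
    h(U (x) Y, Z) = u h(Y, Z) ([dim_intertw_outer_tensor]).

    Write m and m' for the two multiplicities. If chi^- = G(chi), then
    N N m' = u N h(chi, B (x) M) = u^2 h(chi, Cl (x) M) = u^2 N m, that is
    m' = c m. If chi = F(chi^-), then
    N m = u h(chi^-, Cl (x) M) = N m'. *)

(** * Linear maps and dimensions of subspaces *)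

(** Unlike [lfun_simp], this rewrites [\1 x] to [x] itself and not to an
    application of the identity as a bundled linear map. *)
Definition lfunS :=
  (comp_lfunE, scale_lfunE, opp_lfunE, add_lfunE, sum_lfunE, id_lfunE,
   zero_lfunE).

Section Lfun.
Variables (F : fieldType) (V W : vectType F).

Definition lfun_of (f : V -> W) (lf : linear f) : 'Hom(V, W) :=
  let fL := GRing.isLinear.Build _ _ _ _ f lf in
  linfun (HB.pack f fL : {linear V -> W}).

Lemma lfun_ofE (f : V -> W) (lf : linear f) x : lfun_of lf x = f x.
Proof. by rewrite lfunE. Qed.

Lemma lfun_exists (f : V -> W) : linear f -> {g : 'Hom(V, W) | g =1 f}.
Proof. by move=> lf; exists (lfun_of lf) => x; rewrite lfun_ofE. Qed.

(** Forms of [linearN], ... whose right-hand sides mention [f] itself, so that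
    they chain with rewriting rules about [f x]. *)
Lemma lfunN (f : 'Hom(V, W)) x : f (- x) = - f x. Proof. exact: linearN. Qed.
Lemma lfunD (f : 'Hom(V, W)) x y : f (x + y) = f x + f y.
Proof. exact: linearD. Qed.
Lemma lfunZ (f : 'Hom(V, W)) a x : f (a *: x) = a *: f x.
Proof. exact: linearZ. Qed.
Lemma lfun_sum (f : 'Hom(V, W)) I r (P : pred I) (E : I -> V) :
  f (\sum_(i <- r | P i) E i) = \sum_(i <- r | P i) f (E i).
Proof. exact: linear_sum. Qed.

Lemma mem_vspan_closed (P : V -> Prop) :
  P 0 -> (forall a x y, P x -> P y -> P (a *: x + y)) ->
  forall x, x \in vspan P <-> P x.
Proof.
move=> P0 Pl x; split; last exact: mem_vspan.
case/vspanP => s sP /(@coord_span _ _ _ (in_tuple s)) ->.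
elim/big_rec: _ => // i y _ Py; apply: Pl => //.
by apply: sP; apply: mem_nth.
Qed.

Lemma dim_le_inj (A : {vspace V}) (B : {vspace W}) (f : 'Hom(V, W)) :
  (forall x, x \in A -> f x \in B) ->
  (forall x, x \in A -> f x = 0 -> x = 0) -> (\dim A <= \dim B)%N.
Proof.
move=> fAB f0; rewrite -(@limg_dim_eq _ _ _ f A); last first.
  apply/eqP; rewrite -subv0; apply/subvP => x.
  rewrite memv_cap memv_ker => /andP[xA /eqP fx].
  by rewrite (f0 x xA fx) mem0v.
by apply: dimvS; apply/subvP => _ /memv_imgP[x xA ->]; apply: fAB.
Qed.

End Lfun.

Lemma dim_bij (F : fieldType) (V W : vectType F) (A : {vspace V})
    (B : {vspace W}) (f : 'Hom(V, W)) (g : 'Hom(W, V)) :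
  (forall x, x \in A -> f x \in B) -> (forall y, y \in B -> g y \in A) ->
  (forall x, x \in A -> g (f x) = x) -> (forall y, y \in B -> f (g y) = y) ->
  \dim A = \dim B.
Proof.
move=> fAB gBA gf fg; apply/eqP; rewrite eqn_leq; apply/andP; split.
  apply: (dim_le_inj fAB) => x xA fx.
  by rewrite -(gf x xA) fx linear0.
apply: (dim_le_inj gBA) => y yB gy.
by rewrite -(fg y yB) gy linear0.
Qed.

(** The images of the [i q] are independent, being separated by the [p q]. *)
Lemma dim_copies (F : fieldType) (V V' : vectType F) m
    (A : {vspace V}) (B : {vspace V'})
    (i : 'I_m -> 'Hom(V', V)) (p : 'I_m -> 'Hom(V, V')) :
  (forall q x, x \in A -> p q x \in B) -> (forall q y, y \in B -> i q y \in A) ->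
  (forall q r y, p q (i r y) = if q == r then y else 0) ->
  (forall x, \sum_q i q (p q x) = x) ->
  \dim A = (m * \dim B)%N.
Proof.
move=> pAB iBA pi ip.
have -> : A = (\sum_q (i q @: B))%VS.
  apply/eqP; rewrite eqEsubv; apply/andP; split.
    apply/subvP => x xA; rewrite -(ip x); apply: memv_sumr => q _.
    by apply: memv_img; apply: pAB.
  apply/subv_sumP => q _; apply/subvP => _ /memv_imgP[y yB ->]; exact: iBA.
rewrite (directvP _) /=; last first.
  apply/directv_sum_independent => us us_in us0 q _.
  have /memv_imgP [y yB uq] := us_in q isT.
  have: p q (\sum_q us q) = 0 by rewrite us0 linear0.
  rewrite linear_sum (bigD1 q) //= big1 => [|r rq].
    by rewrite addr0 uq pi eqxx => ->; rewrite linear0.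
  by have /memv_imgP [z _ ->] := us_in r isT; rewrite pi eq_sym (negPf rq).
rewrite (eq_bigr (fun => \dim B)) ?sum_nat_const ?card_ord // => q _.
apply: limg_dim_eq; apply/eqP; rewrite -subv0; apply/subvP => y.
rewrite memv_cap memv_ker => /andP[_ /eqP iy].
by have := pi q q y; rewrite eqxx iy linear0 => <-; rewrite mem0v.
Qed.

(** * Halving dimensions with anticommuting operators *)

Section Halving.
Variables (F : numFieldType) (V : vectType F).

Definition fixv (r : 'End(V)) : {vspace V} := lker (r - \1%VF).

Lemma mem_fixv r x : (x \in fixv r) = (r x == x).
Proof. by rewrite memv_ker !lfunS subr_eq0. Qed.

(** [a] maps each eigenspace of [r] injectively into the other one. *)
Lemma dim_half (S : {vspace V}) (r a : 'End(V)) :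
  (forall x, r (r x) = x) -> (forall x, r (a x) = - a (r x)) ->
  (forall x, a x = 0 -> x = 0) ->
  (forall x, x \in S -> r x \in S) -> (forall x, x \in S -> a x \in S) ->
  \dim S = (2 * \dim (S :&: fixv r))%N.
Proof.
move=> rr ra a0 rS aS; set P := (_ :&: _)%VS; pose M := (S :&: fixv (- r))%VS.
have memP x : (x \in P) = (x \in S) && (r x == x).
  by rewrite memv_cap mem_fixv.
have memM x : (x \in M) = (x \in S) && (r x == - x).
  by rewrite memv_cap mem_fixv !lfunS eqr_oppLR.
have h2 : (2 : F) != 0 by rewrite pnatr_eq0.
have dPM : \dim P = \dim M.
  apply/eqP; rewrite eqn_leq; apply/andP; split.
    apply: (@dim_le_inj _ _ _ _ _ a) => [x|x _]; last exact: a0.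
    by rewrite memP memM => /andP[xS /eqP rx]; rewrite aS //= ra rx.
  apply: (@dim_le_inj _ _ _ _ _ a) => [x|x _]; last exact: a0.
  by rewrite memP memM => /andP[xS /eqP rx]; rewrite aS //= ra rx linearN opprK.
have -> : S = (P + M)%VS.
  apply/eqP; rewrite eqEsubv; apply/andP; split; last first.
    by rewrite subv_add !capvSl.
  apply/subvP => x xS.
  have -> : x = 2^-1 *: (x + r x) + 2^-1 *: (x - r x).
    by rewrite -scalerDr addrACA subrr addr0 -mulr2n -scaler_nat scalerA mulVf
      ?scale1r.
  rewrite memv_add // memvZ // ?memP ?memM.
    by rewrite memvD ?rS //= linearD /= rr (addrC (r x)) eqxx.
  by rewrite memvB ?rS //= linearB /= rr opprB eqxx.
rewrite dimv_disjoint_sum ?mul2n -?addnn ?dPM //.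
apply/eqP; rewrite -subv0; apply/subvP => x; rewrite memv_cap memP memM.
case/andP => /andP[_ /eqP ->] /andP[_ xx]; rewrite memv0.
by move: xx; rewrite -addr_eq0 -mulr2n -scaler_nat scaler_eq0 (negPf h2).
Qed.

(** The operator [a i] commutes with the other involutions, so it still acts on
    their common fixed points and [dim_half] applies again. *)
Lemma dim_halving n (S : {vspace V}) (r a : 'I_n -> 'End(V)) :
  (forall i x, r i (r i x) = x) ->
  (forall i j x, r i (r j x) = r j (r i x)) ->
  (forall i x, r i (a i x) = - a i (r i x)) ->
  (forall i j x, i != j -> r i (a j x) = a j (r i x)) ->
  (forall i x, a i x = 0 -> x = 0) ->
  (forall i x, x \in S -> r i x \in S) -> (forall i x, x \in S -> a i x \in S) ->
  (2 ^ n * \dim (S :&: \bigcap_i fixv (r i)))%N = \dim S.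
Proof.
move=> rr rC ra raC a0 rS aS.
suff H (l : seq 'I_n) : uniq l ->
    (2 ^ size l * \dim (S :&: \bigcap_(i <- l) fixv (r i)))%N = \dim S.
  have := H (enum 'I_n) (enum_uniq _).
  by rewrite size_enum_ord big_enum.
have memI (t : seq 'I_n) x : (x \in \bigcap_(i <- t) fixv (r i))%VS =
    all (fun i => r i x == x) t.
  elim: t => [|i t IH]; first by rewrite big_nil memvf.
  by rewrite big_cons memv_cap mem_fixv /= IH.
elim: l => [|i l IH] /=; first by rewrite big_nil capvf mul1n.
case/andP => il ul; rewrite -(IH ul) expnSr -mulnA; congr (_ * _)%N.
rewrite (@dim_half (S :&: \bigcap_(j <- l) fixv (r j)) (r i) (a i)) //.
- by rewrite big_cons (capvC (fixv _)) capvA.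
- exact: a0.
- move=> x; rewrite !memv_cap !memI => /andP[xS /allP h]; rewrite rS //=.
  by apply/allP => j jl; rewrite rC (eqP (h j jl)).
move=> x; rewrite !memv_cap !memI => /andP[xS /allP h]; rewrite aS //=.
apply/allP => j jl; rewrite raC ?(eqP (h j jl)) //.
by apply: contraNneq il => <-.
Qed.

End Halving.

(** * Spaces of intertwining maps *)

Section Intertwiners.
Variable F : fieldType.
Implicit Types V W X Y Z : vectType F.

Definition intertw (I : Type) V W (a : I -> 'End(V)) (b : I -> 'End(W)) :
    {vspace 'Hom(V, W)} :=
  vspan (fun f : 'Hom(V, W) => forall i x, f (a i x) = b i (f x)).

Lemma mem_intertw I V W (a : I -> 'End(V)) (b : I -> 'End(W))
    (f : 'Hom(V, W)) :
  f \in intertw a b <-> forall i x, f (a i x) = b i (f x).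
Proof.
apply: (mem_vspan_closed
  (P := fun f : 'Hom(V, W) => forall i x, f (a i x) = b i (f x))).
  by move=> i x; rewrite !lfunS linear0.
by move=> c g h Hg Hh i x; rewrite !lfunS Hg Hh linearP.
Qed.

Fact sandwich_linear V V' W W' (g : 'Hom(W, W')) (h : 'Hom(V', V)) :
  linear (fun f : 'Hom(V, W) => (g \o f \o h)%VF).
Proof. by move=> a f f'; apply/lfunP => x; rewrite !lfunS linearP. Qed.

Definition sandwich V V' W W' (g : 'Hom(W, W')) (h : 'Hom(V', V)) :=
  sval (lfun_exists (sandwich_linear g h)).

Lemma sandwichE V V' W W' (g : 'Hom(W, W')) (h : 'Hom(V', V)) (f : 'Hom(V, W)) x :
  sandwich g h f x = g (f (h x)).
Proof. by rewrite (svalP (lfun_exists _)) !lfunS. Qed.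

Lemma dim_intertw_copiesr I Z Y W (TZ : I -> 'End(Z)) (TY : I -> 'End(Y))
    (TW : I -> 'End(W)) m (i : 'I_m -> 'Hom(Y, W)) (p : 'I_m -> 'Hom(W, Y)) :
  (forall q r y, p q (i r y) = if q == r then y else 0) ->
  (forall x, \sum_q i q (p q x) = x) ->
  (forall q t y, i q (TY t y) = TW t (i q y)) ->
  (forall q t x, p q (TW t x) = TY t (p q x)) ->
  \dim (intertw TZ TW) = (m * \dim (intertw TZ TY))%N.
Proof.
move=> pi ip iT pT.
apply: (dim_copies (i := fun q => sandwich (i q) \1)
                   (p := fun q => sandwich (p q) \1)).
- move=> q f /mem_intertw fT; apply/mem_intertw => t x.
  by rewrite !sandwichE !lfunS fT pT.
- move=> q f /mem_intertw fT; apply/mem_intertw => t x.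
  by rewrite !sandwichE !lfunS fT iT.
- move=> q r f; apply/lfunP => x; rewrite !sandwichE !lfunS pi.
  by case: eqP => // _; rewrite zero_lfunE.
move=> f; apply/lfunP => x; rewrite !lfunS.
under eq_bigr do rewrite !sandwichE !lfunS.
by rewrite ip.
Qed.

Lemma dim_intertw_copiesl I Z Y W (TZ : I -> 'End(Z)) (TY : I -> 'End(Y))
    (TW : I -> 'End(W)) m (i : 'I_m -> 'Hom(Y, W)) (p : 'I_m -> 'Hom(W, Y)) :
  (forall q r y, p q (i r y) = if q == r then y else 0) ->
  (forall x, \sum_q i q (p q x) = x) ->
  (forall q t y, i q (TY t y) = TW t (i q y)) ->
  (forall q t x, p q (TW t x) = TY t (p q x)) ->
  \dim (intertw TW TZ) = (m * \dim (intertw TY TZ))%N.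
Proof.
move=> pi ip iT pT.
apply: (dim_copies (i := fun q => sandwich \1 (p q))
                   (p := fun q => sandwich \1 (i q))).
- move=> q f /mem_intertw fT; apply/mem_intertw => t x.
  by rewrite !sandwichE !lfunS iT fT.
- move=> q f /mem_intertw fT; apply/mem_intertw => t x.
  by rewrite !sandwichE !lfunS pT fT.
- move=> q r f; apply/lfunP => x; rewrite !sandwichE !lfunS pi eq_sym.
  by case: eqP => // _; rewrite ?zero_lfunE // linear0.
move=> f; apply/lfunP => x; rewrite !lfunS.
under eq_bigr do rewrite !sandwichE !lfunS.
by rewrite -linear_sum ip.
Qed.

Lemma dim_intertw_isor I Z Y W (TZ : I -> 'End(Z)) (TY : I -> 'End(Y))
    (TW : I -> 'End(W)) (g : 'Hom(Y, W)) (h : 'Hom(W, Y)) :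
  (forall x, g (h x) = x) -> (forall x, h (g x) = x) ->
  (forall t y, g (TY t y) = TW t (g y)) ->
  \dim (intertw TZ TY) = \dim (intertw TZ TW).
Proof.
move=> gh hg gT; have hT t x : h (TW t x) = TY t (h x).
  by rewrite -{1}(gh x) -gT hg.
rewrite (@dim_intertw_copiesr _ _ _ _ TZ TW TY 1 (fun=> h) (fun=> g)) ?mul1n //.
  by move=> q r y; rewrite gh !ord1.
by move=> x; rewrite big_ord1.
Qed.

Lemma dim_intertw_isol I Z Y W (TZ : I -> 'End(Z)) (TY : I -> 'End(Y))
    (TW : I -> 'End(W)) (g : 'Hom(Y, W)) (h : 'Hom(W, Y)) :
  (forall x, g (h x) = x) -> (forall x, h (g x) = x) ->
  (forall t y, g (TY t y) = TW t (g y)) ->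
  \dim (intertw TY TZ) = \dim (intertw TW TZ).
Proof.
move=> gh hg gT; have hT t x : h (TW t x) = TY t (h x).
  by rewrite -{1}(gh x) -gT hg.
rewrite (@dim_intertw_copiesl _ _ _ _ TZ TW TY 1 (fun=> h) (fun=> g)) ?mul1n //.
  by move=> q r y; rewrite gh !ord1.
by move=> x; rewrite big_ord1.
Qed.

End Intertwiners.

(** * Maps between tensor products *)

Section TensorMaps.
Variable F : fieldType.
Implicit Types U M X Y Z V : vectType F.

Lemma tensor_lfun_ext U M V (f g : 'Hom(tensor U M, V)) :
  (forall u x, f (tens u x) = g (tens u x)) -> forall z, f z = g z.
Proof.
move=> fg z; rewrite (tens_basis z) !linear_sum; apply: eq_bigr => j _ /=.
exact: fg.
Qed.

Lemma tensor_lfun U M V (b : U -> M -> V) :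
  (forall x, linear (fun u => b u x)) -> (forall u, linear (b u)) ->
  {f : 'Hom(tensor U M, V) | forall u x, f (tens u x) = b u x}.
Proof.
move=> bl br; pose g (z : tensor U M) := \sum_j b (z j) (vbasis {:M})`_j.
have gl : linear g.
  move=> a y z; rewrite /g scaler_sumr -big_split /=; apply: eq_bigr => j _.
  by rewrite !ffunE bl.
apply: boolp.cid; have [f [fE _]] := tensor_universal bl br; by exists f.
Qed.

Fact tmap_linl U M U' M' (a : 'Hom(U, U')) (b : 'Hom(M, M')) x :
  linear (fun u => tens (a u) (b x)).
Proof. by move=> c u v; rewrite linearP tens_linearl. Qed.

Fact tmap_linr U M U' M' (a : 'Hom(U, U')) (b : 'Hom(M, M')) u :
  linear (fun x => tens (a u) (b x)).
Proof. by move=> c x y; rewrite linearP tens_linearr. Qed.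

Definition tmap U M U' M' (a : 'Hom(U, U')) (b : 'Hom(M, M')) :
    'Hom(tensor U M, tensor U' M') :=
  sval (tensor_lfun (tmap_linl a b) (tmap_linr a b)).

Lemma tmapE U M U' M' (a : 'Hom(U, U')) (b : 'Hom(M, M')) u x :
  tmap a b (tens u x) = tens (a u) (b x).
Proof. exact: (svalP (tensor_lfun _ _)). Qed.

Definition tensl U M (u : U) : 'Hom(M, tensor U M) :=
  sval (lfun_exists (tens_linearr u)).
Definition tensr U M (x : M) : 'Hom(U, tensor U M) :=
  sval (lfun_exists (tens_linearl x)).

Lemma tenslE U M (u : U) (x : M) : tensl M u x = tens u x.
Proof. exact: (svalP (lfun_exists _)). Qed.

Lemma tensrE U M (u : U) (x : M) : tensr U x u = tens u x.
Proof. exact: (svalP (lfun_exists _)). Qed.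

Lemma tens0l U M (x : M) : tens (0 : U) x = 0.
Proof. by rewrite -tensrE linear0. Qed.

Lemma tensNl U M (u : U) (x : M) : tens (- u) x = - tens u x.
Proof. by rewrite -!tensrE linearN. Qed.

Lemma tensNr U M (u : U) (x : M) : tens u (- x) = - tens u x.
Proof. by rewrite -!tenslE linearN. Qed.

Lemma tensZl U M a (u : U) (x : M) : tens (a *: u) x = a *: tens u x.
Proof. by rewrite -!tensrE linearZ. Qed.

Lemma tensZr U M a (u : U) (x : M) : tens u (a *: x) = a *: tens u x.
Proof. by rewrite -!tenslE linearZ. Qed.

Lemma tensDl U M (u v : U) (x : M) : tens (u + v) x = tens u x + tens v x.
Proof. by rewrite -!tensrE linearD. Qed.

Let bas V := vbasis {:V}.

Lemma bas_free V : free (bas V).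
Proof. exact: basis_free (vbasisP _). Qed.

Fact contr_linl U M i (x : M) : linear (fun u : U => coord (bas U) i u *: x).
Proof. by move=> c u v; rewrite linearP scalerDl scalerA. Qed.

Fact contr_linr U M i (u : U) : linear (fun x : M => coord (bas U) i u *: x).
Proof. by move=> c x y; rewrite scalerDr !scalerA mulrC. Qed.

Definition contrl U M i : 'Hom(tensor U M, M) :=
  sval (tensor_lfun (contr_linl i) (contr_linr i)).

Lemma contrlE U M i (u : U) (x : M) :
  contrl M i (tens u x) = coord (bas U) i u *: x.
Proof. exact: (svalP (tensor_lfun _ _)). Qed.

Definition contrr U M j : 'Hom(tensor U M, U) :=
  sval (tensor_lfun (contr_linr j) (contr_linl j)).

Lemma contrrE U M j (u : U) (x : M) :
  contrr U j (tens u x) = coord (bas M) j x *: u.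
Proof. exact: (svalP (tensor_lfun _ _)). Qed.

Lemma contrl_tensl U M (q r : 'I_(\dim {:U})) (x : M) :
  contrl M q (tensl M (bas U)`_r x) = if q == r then x else 0.
Proof.
rewrite tenslE contrlE coord_free ?bas_free // eq_sym.
by case: eqP; rewrite (scale1r, scale0r).
Qed.

Lemma sum_tensl U M (z : tensor U M) :
  \sum_(q < \dim {:U}) tensl M (bas U)`_q (contrl M q z) = z.
Proof.
pose f : 'End(tensor U M) :=
  (\sum_(q < \dim {:U}) (tensl M (bas U)`_q \o contrl M q))%VF.
have: f z = \1%VF z; last first.
  by rewrite !lfunS => fz; rewrite -[RHS]fz; apply: eq_bigr => q _;
    rewrite !lfunS.
apply: tensor_lfun_ext => u x; rewrite !lfunS.
under eq_bigr do rewrite !lfunS contrlE tenslE tensZr -tensZl -tensrE.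
rewrite -linear_sum -coord_vbasis ?memvf //. exact: tensrE.
Qed.

Lemma contrr_tensr U M (q r : 'I_(\dim {:M})) (u : U) :
  contrr U q (tensr U (bas M)`_r u) = if q == r then u else 0.
Proof.
rewrite tensrE contrrE coord_free ?bas_free // eq_sym.
by case: eqP; rewrite (scale1r, scale0r).
Qed.

Lemma sum_tensr U M (z : tensor U M) :
  \sum_(q < \dim {:M}) tensr U (bas M)`_q (contrr U q z) = z.
Proof.
pose f : 'End(tensor U M) :=
  (\sum_(q < \dim {:M}) (tensr U (bas M)`_q \o contrr U q))%VF.
have: f z = \1%VF z; last first.
  by rewrite !lfunS => fz; rewrite -[RHS]fz; apply: eq_bigr => q _;
    rewrite !lfunS.
apply: tensor_lfun_ext => u x; rewrite !lfunS.
under eq_bigr do rewrite !lfunS contrrE tensrE tensZl -tensZr -tenslE.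
rewrite -linear_sum -coord_vbasis ?memvf //; exact: tenslE.
Qed.

Lemma tmap_comp U M U' M' U'' M'' (a : 'Hom(U, U')) (b : 'Hom(M, M'))
    (a' : 'Hom(U', U'')) (b' : 'Hom(M', M'')) z :
  tmap a' b' (tmap a b z) = tmap (a' \o a) (b' \o b) z.
Proof.
rewrite -[LHS]comp_lfunE; apply: tensor_lfun_ext => u x.
by rewrite !lfunS !tmapE !lfunS.
Qed.

Lemma tmap11 U M z : tmap (\1 : 'End(U)) (\1 : 'End(M)) z = z.
Proof.
rewrite -[RHS](id_lfunE z); apply: tensor_lfun_ext => u x.
by rewrite tmapE !lfunS.
Qed.

Lemma tmap_eq U M U' M' (a a' : 'Hom(U, U')) (b b' : 'Hom(M, M')) z :
  a =1 a' -> b =1 b' -> tmap a b z = tmap a' b' z.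
Proof. by move=> /lfunP -> /lfunP ->. Qed.

End TensorMaps.

(** * Counting maps that commute with Clifford operators *)

Section Clifford.
Variables (F : numFieldType) (n : nat).
Implicit Types (X Y U V Z M : vectType F).

(** A graded module over the Clifford algebra of an orthonormal basis, given by
    operators; [s] is the parity operator. *)
Record clifford_ops X (e : 'I_n -> 'End(X)) (s : 'End(X)) : Prop := CliffordOps {
  parK : forall x, s (s x) = x;
  par_cl : forall k x, s (e k x) = - e k (s x);
  clK : forall k x, e k (e k x) = x;
  clC : forall k l x, k != l -> e k (e l x) = - e l (e k x) }.

Lemma scale_half X (x : X) : 2^-1 *: (x + x) = x.
Proof. by rewrite -mulr2n -scaler_nat scalerA mulVf ?scale1r ?pnatr_eq0. Qed.

(** Halving with [r k f = e' k f e k] and [a k f = e' k (s' f)]. The factor [s']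
    makes [a k] commute with [r l] for [l != k], and lets it preserve any
    subspace of maps that commute with operators anticommuting with both [e']
    and [s']. *)
Lemma dim_clifford_commutant X Y (e : 'I_n -> 'End(X)) (s : 'End(X))
    (e' : 'I_n -> 'End(Y)) (s' : 'End(Y)) (S : {vspace 'Hom(X, Y)}) :
  clifford_ops e s -> clifford_ops e' s' ->
  (forall k f, f \in S -> (e' k \o f \o e k)%VF \in S) ->
  (forall k f, f \in S -> (e' k \o s' \o f)%VF \in S) ->
  (2 ^ n * \dim (S :&: intertw e e'))%N = \dim S.
Proof.
move=> ce ce' rS aS.
pose r k := sandwich (e' k) (e k).
pose a k := sandwich (e' k \o s')%VF (\1 : 'End(X)).
rewrite -(@dim_halving _ _ n S r a) //.
- congr (2 ^ n * \dim (S :&: _))%N; apply/vspaceP => f.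
  apply/idP/idP.
    move/mem_intertw => fe; rewrite memvE; apply/subv_bigcapP => k _.
    rewrite -memvE mem_fixv; apply/eqP/lfunP => x.
    by rewrite sandwichE fe (clK ce').
  rewrite memvE => /subv_bigcapP h; apply/mem_intertw => k x.
  have := h k isT; rewrite -memvE mem_fixv => /eqP/lfunP/(_ (e k x)).
  by rewrite sandwichE (clK ce).
- by move=> k f; apply/lfunP => x; rewrite !sandwichE (clK ce) (clK ce').
- move=> k l f; apply/lfunP => x; rewrite !sandwichE.
  have [->//|kl] := eqVneq k l.
  by rewrite (clC ce') // (clC ce) 1?eq_sym // !lfunN opprK.
- move=> k f; apply/lfunP => x; rewrite !(lfunS, sandwichE) (par_cl ce') lfunN.
  by rewrite opprK !(clK ce').
- move=> k l f kl; apply/lfunP => x; rewrite !(lfunS, sandwichE).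
  by rewrite (par_cl ce') lfunN (clC ce') // lfunN opprK.
- move=> k f /lfunP h; apply/lfunP => x; have := h x; rewrite !(lfunS, sandwichE).
  move/(congr1 (e' k)); rewrite (clK ce') linear0 => /(congr1 s').
  by rewrite (parK ce') linear0.
- move=> k f /(rS k); congr (_ \in S); apply/lfunP => x.
  by rewrite !(lfunS, sandwichE).
move=> k f /(aS k); congr (_ \in S); apply/lfunP => x.
by rewrite !(lfunS, sandwichE).
Qed.

Lemma dim_clifford_intertw X Y (e : 'I_n -> 'End(X)) (s : 'End(X))
    (e' : 'I_n -> 'End(Y)) (s' : 'End(Y)) I (T : I -> 'End(X)) (T' : I -> 'End(Y)) :
  clifford_ops e s -> clifford_ops e' s' ->
  (forall i k x, T i (e k x) = - e k (T i x)) ->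
  (forall i k x, T' i (e' k x) = - e' k (T' i x)) ->
  (forall i x, T' i (s' x) = - s' (T' i x)) ->
  (2 ^ n * \dim (intertw T T' :&: intertw e e'))%N = \dim (intertw T T').
Proof.
move=> ce ce' Te Te' Ts'; apply: (dim_clifford_commutant ce ce') => k f
  /mem_intertw fT; apply/mem_intertw => i x; rewrite !lfunS.
  by rewrite -[e k (T i x)]opprK -Te lfunN fT lfunN -Te'.
by rewrite fT Te' Ts' lfunN opprK.
Qed.

Lemma dim_clifford_hom X Y (e : 'I_n -> 'End(X)) (s : 'End(X))
    (e' : 'I_n -> 'End(Y)) (s' : 'End(Y)) :
  clifford_ops e s -> clifford_ops e' s' ->
  (2 ^ n * \dim (intertw e e'))%N = (\dim {:X} * \dim {:Y})%N.
Proof.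
move=> ce ce'; rewrite -[intertw e e']capfv.
by rewrite (dim_clifford_commutant ce ce') ?dimvf // => *; rewrite memvf.
Qed.

(** The product over [k] of the [(1 + r k) / 2]. *)
Lemma averaging_projector X (r : 'I_n -> 'End(X)) :
  (forall k x, r k (r k x) = x) ->
  (forall k l x, r k (r l x) = r l (r k x)) ->
  exists P : 'End(X),
  [/\ forall k x, r k (P x) = P x,
      forall x, (forall k, r k x = x) -> P x = x,
      forall Z (h : 'Hom(X, Z)), (forall k x, h (r k x) = h x) ->
        forall x, h (P x) = h x &
      forall A : 'End(X), (forall k x, A (r k x) = r k (A x)) ->
        forall x, A (P x) = P (A x)].
Proof.
move=> rK rC.
suff [P [P1 P2 P3 P4]] : exists P : 'End(X),
  [/\ forall k x, k \in enum 'I_n -> r k (P x) = P x,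
      forall x, (forall k, r k x = x) -> P x = x,
      forall Z (h : 'Hom(X, Z)), (forall k x, h (r k x) = h x) ->
        forall x, h (P x) = h x &
      forall A : 'End(X), (forall k x, A (r k x) = r k (A x)) ->
        forall x, A (P x) = P (A x)].
  by exists P; split => // k x; apply: P1; rewrite mem_enum.
elim: (enum _) => [|k l [P [P1 P2 P3 P4]]].
  by exists \1%VF; split => *; rewrite !lfunS.
exists (2^-1 *: (P + (r k \o P)))%VF; split.
- move=> i x; rewrite inE !lfunS lfunZ lfunD => /orP[/eqP ->|il] /=.
    by rewrite rK addrC.
  by rewrite rC !(P1 i).
- by move=> x rx; rewrite !lfunS P2 // rx scale_half.
- by move=> Z h hr x; rewrite !lfunS lfunZ lfunD /= hr P3 // scale_half.
by move=> A Ar x; rewrite !lfunS lfunZ lfunD /= Ar P4.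
Qed.

(** [G] is the space of super homomorphisms over the Clifford algebra, cut out
    of [Hom(U, X)] by the involutions [r k f = e' s' f s e]: a map of parity p
    satisfies [s' f s = (-1)^p f], which produces the sign in [f e]. Halving is
    applied to the maps [Hom(U, X) -> Z] that are invariant under
    precomposition with the [r k]; these correspond to the maps [G -> Z] because
    the averaging projector splits the inclusion of [G]. Precomposition of [f]
    with [e k] serves as the operator exchanging eigenspaces, since it commutes
    with the action of [T] on values. *)
Lemma dim_intertw_clifford_hom U X Z (e : 'I_n -> 'End(U)) (s : 'End(U))
    (e' : 'I_n -> 'End(X)) (s' : 'End(X)) I (T : I -> 'End(X)) (TZ : I -> 'End(Z))
    (G : {vspace 'Hom(U, X)}) (TG : I -> 'End(subvs_of G)) :
  clifford_ops e s -> clifford_ops e' s' ->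
  (forall i k x, T i (e' k x) = - e' k (T i x)) ->
  (forall i x, T i (s' x) = - s' (T i x)) ->
  (forall f, f \in G <-> forall k u, f (e k u) = e' k (s' (f (s u)))) ->
  (forall i f u, vsval (TG i f) u = T i (vsval f u)) ->
  (2 ^ n * \dim (intertw TG TZ))%N = (\dim {:U} * \dim (intertw T TZ))%N.
Proof.
move=> ce ce' Te' Ts' memG TGE.
pose V : vectType F := 'Hom(U, X).
pose TV i : 'End(V) := sandwich (T i) (\1 : 'End(U)).
have TVE i f u : TV i f u = T i (f u) by rewrite sandwichE !lfunS.
pose r k : 'End(V) := sandwich (e' k \o s')%VF (s \o e k)%VF.
have rE k f u : r k f u = e' k (s' (f (s (e k u)))) by rewrite sandwichE !lfunS.
pose a k : 'End(V) := sandwich (\1 : 'End(X)) (e k).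
have aE k f u : a k f u = f (e k u) by rewrite sandwichE !lfunS.
have rK k f : r k (r k f) = f.
  apply/lfunP => u; rewrite !rE !(par_cl ce, par_cl ce') !lfunN /=.
  by rewrite !(clK ce, clK ce', par_cl ce, par_cl ce', lfunN, parK ce,
    parK ce', opprK).
have rC k l f : r k (r l f) = r l (r k f).
  apply/lfunP => u; rewrite !rE.
  have [->//|kl] := eqVneq k l.
  rewrite !(par_cl ce, par_cl ce') !lfunN /= !(par_cl ce, par_cl ce') !lfunN /=.
  rewrite (clC ce') // (clC ce) 1?eq_sym // !lfunN !opprK.
  by rewrite !(parK ce, parK ce').
have rTV k i f : TV i (r k f) = r k (TV i f).
  by apply/lfunP => u; rewrite TVE !rE TVE Te' Ts' lfunN opprK.
have memGr f : f \in G <-> forall k, r k f = f.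
  rewrite memG; split=> [h k|h k u].
    by apply/lfunP => u; rewrite rE -h (clK ce).
  by rewrite -{1}(h k) rE (clK ce).
have [P [rP Pid Ph PA]] := averaging_projector rK rC.
have PG f : P f \in G by apply/memGr => k; apply: rP.
(* [V] is a sum of copies of [X], indexed by a basis of [U] *)
have <- : \dim (intertw TV TZ) = (\dim {:U} * \dim (intertw T TZ))%N.
  have lin_i (q : 'I_(\dim {:U})) (x : X) :
      linear (fun u : U => coord (vbasis {:U}) q u *: x).
    by move=> c u v; rewrite linearP scalerDl scalerA.
  have lin_i' q : linear (fun x => lfun_of (lin_i q x) : V).
    move=> c x y; apply/lfunP => u; rewrite !lfunS !lfun_ofE scalerDr !scalerA.
    by rewrite mulrC.
  have lin_p (q : 'I_(\dim {:U})) : linear (fun f : V => f (vbasis {:U})`_q).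
    by move=> c f g; rewrite !lfunS.
  have iE q x u : lfun_of (lin_i' q) x u = coord (vbasis {:U}) q u *: x.
    by rewrite !lfun_ofE.
  have bf : free (vbasis {:U}) by exact: basis_free (vbasisP _).
  apply: (dim_intertw_copiesl _ (i := fun q => lfun_of (lin_i' q))
                                (p := fun q => lfun_of (lin_p q))).
  - move=> q l x; rewrite lfun_ofE iE coord_free // eq_sym.
    by case: eqP; rewrite (scale1r, scale0r).
  - move=> f; apply/lfunP => u; rewrite !lfunS.
    under eq_bigr do rewrite iE lfun_ofE -lfunZ.
    by rewrite -linear_sum -coord_vbasis ?memvf.
  - move=> q i x; apply/lfunP => u; rewrite iE -lfunZ -iE; exact/esym/TVE.
  by move=> q i f; rewrite !lfun_ofE; exact: TVE.
apply: etrans; last apply: (@dim_halving _ _ n (intertw TV TZ)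
  (fun k => sandwich (\1 : 'End(Z)) (r k)) (fun k => sandwich (\1 : 'End(Z)) (a k))).
- congr (_ * _)%N; symmetry.
  have lP : linear (fun f => vsproj G (P f)) by move=> c f g; rewrite !linearP.
  have lv : linear (fun f : subvs_of G => vsval f) by exact: linearP.
  apply: (dim_bij (f := sandwich (\1 : 'End(Z)) (lfun_of lv))
                  (g := sandwich (\1 : 'End(Z)) (lfun_of lP))).
  + move=> h; rewrite memv_cap => /andP[/mem_intertw hT _]; apply/mem_intertw.
    move=> i f; rewrite !(sandwichE, lfunS) !lfun_ofE -hT; congr (h _).
    by apply/lfunP => u; rewrite TGE TVE.
  + move=> g /mem_intertw gT; rewrite memv_cap; apply/andP; split.
      apply/mem_intertw => i f; rewrite !(sandwichE, lfunS) !lfun_ofE -gT.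
      congr (g _); apply: val_inj; rewrite /= [LHS]vsprojK ?PG // -PA //.
      by apply/lfunP => u; rewrite TVE TGE vsprojK ?PG.
    rewrite memvE; apply/subv_bigcapP => k _; rewrite -memvE mem_fixv.
    apply/eqP/lfunP => f; rewrite !(sandwichE, lfunS) !lfun_ofE.
    congr (g (vsproj G _)); rewrite -[LHS](rP k).
    by rewrite -PA // rK.
  + move=> h; rewrite memv_cap => /andP[_].
    rewrite memvE => /subv_bigcapP hr; apply/lfunP => f.
    rewrite !(sandwichE, lfunS) !lfun_ofE vsprojK //; apply: Ph => k f'.
    have := hr k isT; rewrite -memvE mem_fixv => /eqP/lfunP/(_ f').
    by rewrite sandwichE !lfunS.
  move=> g _; apply/lfunP => f; rewrite !(sandwichE, lfunS) !lfun_ofE.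
  rewrite Pid ?vsvalK //; apply/memGr; exact: subvsP.
- by move=> k h; apply/lfunP => f; rewrite !(sandwichE, lfunS) rK.
- by move=> k l h; apply/lfunP => f; rewrite !(sandwichE, lfunS) rC.
- move=> k h; apply/lfunP => f; rewrite !(sandwichE, lfunS).
  rewrite -lfunN; congr (h _); apply/lfunP => u; rewrite !(aE, rE, lfunS).
  by rewrite !(par_cl ce, clK ce, lfunN, opprK).
- move=> k l h kl; apply/lfunP => f; rewrite !(sandwichE, lfunS).
  congr (h _); apply/lfunP => u; rewrite !(aE, rE, lfunS).
  by rewrite (clC ce) // !(par_cl ce, lfunN, opprK).
- move=> k h /lfunP h0; apply/lfunP => f; have := h0 (a k f).
  rewrite !(sandwichE, lfunS) => <-; congr (h _); apply/lfunP => u.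
  by rewrite !aE (clK ce).
- move=> k h /mem_intertw hT; apply/mem_intertw => i f.
  by rewrite !(sandwichE, lfunS) -rTV hT.
move=> k h /mem_intertw hT; apply/mem_intertw => i f.
rewrite !(sandwichE, lfunS) -hT; congr (h _); apply/lfunP => u.
by rewrite !(TVE, aE).
Qed.

End Clifford.

(** * Twisting and swapping tensor factors *)

Section TwistSwap.
Variable F : numFieldType.
Implicit Types (X Y U V Z M : vectType F).

Lemma tensor_lfun_ext_par U Y V (s : 'End(U)) (f g : 'Hom(tensor U Y, V)) :
  (forall u, s (s u) = u) ->
  (forall c u y, c * c = 1 -> s u = c *: u -> f (tens u y) = g (tens u y)) ->
  forall z, f z = g z.
Proof.
move=> ss fg; apply: tensor_lfun_ext => u y.
have -> : u = 2^-1 *: (u + s u) + 2^-1 *: (u - s u).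
  by rewrite -scalerDr addrACA subrr addr0 scale_half.
rewrite tensDl !tensZl !lfunD !lfunZ (fg 1) ?(fg (-1)) ?mulr1 ?mulrNN ?mul1r //.
  by rewrite linearB /= ss scaleN1r opprB.
by rewrite linearD /= ss scale1r addrC.
Qed.

(** [tw] is [s'] on odd [u] and the identity on even [u]: moving [A] past [s']
    costs the same sign as the Koszul sign [s u]. *)
Lemma koszul_untwist U Y (s : 'End(U)) (s' : 'End(Y)) :
  (forall u, s (s u) = u) -> (forall y, s' (s' y) = y) ->
  exists tw : 'End(tensor U Y), (forall z, tw (tw z) = z) /\
    forall A : 'End(Y), (forall y, A (s' y) = - s' (A y)) ->
      forall z, tw (tmap \1 A z) = tmap s A (tw z).
Proof.
move=> ss ss'.
pose tw : 'End(tensor U Y) :=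
  (2^-1 *: (tmap (\1 + s) \1 + tmap (\1 - s) s'))%VF.
have twE c u y : c * c = 1 -> s u = c *: u ->
    tw (tens u y) = if c == 1 then tens u y else tens u (s' y).
  move=> /eqP cc su; rewrite /tw !lfunS !tmapE !lfunS su.
  move: cc su; rewrite -expr2 sqrf_eq1 => /orP[] /eqP -> su.
    by rewrite eqxx scale1r subrr tens0l addr0 tensDl scale_half.
  have /negPf -> : (-1 : F) != 1 by rewrite eqNr oner_eq0.
  by rewrite scaleN1r opprK subrr tens0l add0r tensDl scale_half.
move: twE; clearbody tw => twE; exists tw; split.
  move=> z; rewrite -comp_lfunE -[RHS]id_lfunE.
  apply: (tensor_lfun_ext_par ss) => c u y cc su; rewrite !lfunS !(twE c) //.
  by case c1: (c == 1); rewrite (twE c) // c1 ?ss'.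
move=> A As z; rewrite -[LHS]comp_lfunE -[RHS]comp_lfunE.
apply: (tensor_lfun_ext_par ss) => c u y cc su.
rewrite !lfunS !tmapE !lfunS !(twE c) //.
case: eqP => [c1|c1]; rewrite tmapE su; first by rewrite c1 scale1r.
have /eqP -> : c == -1.
  by move/eqP: cc; rewrite -expr2 sqrf_eq1 => /orP[/eqP|].
by rewrite As tensNr scaleN1r tensNl opprK.
Qed.

(** The family [tmap s (T i)] is the Koszul action of odd elements on the second
    factor of an outer tensor product. *)
Lemma dim_intertw_outer_tensor I U Y Z (s : 'End(U)) (s' : 'End(Y))
    (T : I -> 'End(Y)) (TZ : I -> 'End(Z)) :
  (forall u, s (s u) = u) -> (forall y, s' (s' y) = y) ->
  (forall i y, T i (s' y) = - s' (T i y)) ->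
  \dim (intertw (fun i => tmap s (T i)) TZ) = (\dim {:U} * \dim (intertw T TZ))%N.
Proof.
move=> ss ss' Ts; have [tw [twK twT]] := koszul_untwist ss ss'.
have iso : \dim (intertw (fun i => tmap \1 (T i) : 'End(tensor U Y)) TZ) =
           \dim (intertw (fun i => tmap s (T i)) TZ).
  by apply: (dim_intertw_isol _ twK twK) => i z; apply: twT.
rewrite -iso; apply: (dim_intertw_copiesl (p := fun q => contrl Y q) _
   (i := fun q => tensl Y (vbasis {:U})`_q)).
- exact: contrl_tensl.
- exact: sum_tensl.
- by move=> q i y; rewrite !tenslE tmapE lfunS.
move=> q i z; rewrite -[LHS]comp_lfunE -[RHS]comp_lfunE.
by apply: tensor_lfun_ext => u y; rewrite !lfunS tmapE !contrlE lfunS lfunZ.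
Qed.

Section Swap.
Variables (n : nat) (X X' : vectType F).
Variables (e : 'I_n -> 'End(X)) (s : 'End(X)).
Variables (e' : 'I_n -> 'End(X')) (s' : 'End(X')).
Hypotheses (ce : clifford_ops e s) (ce' : clifford_ops e' s').
Let P := tensor X X'.

Let L k : 'End(P) := tmap (e k) \1.
Let R k : 'End(P) := tmap s (e' k).
Let c : F := (-1) ^+ n.+1.
Let q k : 'End(P) := (L k + c *: R k)%VF.

Let cc : c * c = 1.
Proof. by rewrite -expr2 sqrr_sign. Qed.

Let LL k z : L k (L k z) = z.
Proof.
rewrite -comp_lfunE -[RHS]id_lfunE; apply: tensor_lfun_ext => x y.
by rewrite !(lfunS, tmapE) (clK ce).
Qed.

Let RR k z : R k (R k z) = z.
Proof.
rewrite -comp_lfunE -[RHS]id_lfunE; apply: tensor_lfun_ext => x y.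
by rewrite !(lfunS, tmapE) (clK ce') (parK ce).
Qed.

Let LR k l z : L k (R l z) = - R l (L k z).
Proof.
have -> : L k (R l z) = (L k \o R l)%VF z by rewrite lfunS.
have -> : - R l (L k z) = (- (R l \o L k))%VF z by rewrite !lfunS.
apply: tensor_lfun_ext => x y; rewrite !(lfunS, tmapE) (par_cl ce).
by rewrite tensNl opprK.
Qed.

Let LC k l z : k != l -> L k (L l z) = - L l (L k z).
Proof.
move=> kl.
have -> : L k (L l z) = (L k \o L l)%VF z by rewrite lfunS.
have -> : - L l (L k z) = (- (L l \o L k))%VF z by rewrite !lfunS.
apply: tensor_lfun_ext => x y; rewrite !(lfunS, tmapE) (clC ce) //.
by rewrite tensNl.
Qed.

Let RC k l z : k != l -> R k (R l z) = - R l (R k z).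
Proof.
move=> kl.
have -> : R k (R l z) = (R k \o R l)%VF z by rewrite lfunS.
have -> : - R l (R k z) = (- (R l \o R k))%VF z by rewrite !lfunS.
apply: tensor_lfun_ext => x y; rewrite !(lfunS, tmapE) (clC ce') //.
by rewrite tensNr.
Qed.

Let qE k z : q k z = L k z + c *: R k z.
Proof. by rewrite !lfunS. Qed.

Let qL k l z : k != l -> q k (L l z) = - L l (q k z).
Proof.
by move=> kl; rewrite !qE lfunD lfunZ LC // opprD !LR scalerN opprK.
Qed.

Let qR k l z : k != l -> q k (R l z) = - R l (q k z).
Proof.
by move=> kl; rewrite !qE lfunD lfunZ RC // opprD !LR scalerN.
Qed.

Let qLk k z : q k (L k z) = c *: R k (q k z).
Proof.
by rewrite !qE lfunD lfunZ LL RR scalerDr scalerA cc scale1r addrC.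
Qed.

Let qq k z : q k (q k z) = 2 *: z.
Proof.
rewrite !qE !lfunD !lfunZ LL RR LR scalerDr scalerA cc scale1r.
rewrite scalerN addrA -[z - _ + _]addrA addNr addr0.
by rewrite scaler_nat mulr2n.
Qed.

(** Write [L] and [R] for the two anticommuting families [e (x) 1] and
    [s (x) e']. Each [q k = L k + c R k] satisfies [q k L k = c R k q k] and
    anticommutes with the other [L l] and [R l], so their product [Q] satisfies
    [Q L l = c (-1)^(n - 1) R l Q]. The sign [c = (-1)^(n + 1)] turns this into
    [Q L l = R l Q], and [koszul_untwist] replaces [s (x) e'] by [1 (x) e']. *)
Lemma clifford_swap : exists Q Q' : 'End(P),
  [/\ forall z, Q (Q' z) = z, forall z, Q' (Q z) = z &
      forall k z, Q (tmap (e k) \1 z) = tmap \1 (e' k) (Q z)].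
Proof.
suff [Q [Q' [QQ' Q'Q _ _ QL]]] : exists Q Q' : 'End(P),
  [/\ forall z, Q (Q' z) = z, forall z, Q' (Q z) = z,
      forall l z, l \notin enum 'I_n ->
        Q (L l z) = (-1) ^+ size (enum 'I_n) *: L l (Q z),
      forall l z, l \notin enum 'I_n ->
        Q (R l z) = (-1) ^+ size (enum 'I_n) *: R l (Q z) &
      forall l z, l \in enum 'I_n ->
        Q (L l z) = (c * (-1) ^+ (size (enum 'I_n)).+1) *: R l (Q z)].
  have [tw [twK twT]] := koszul_untwist (parK ce) (parK ce').
  exists (tw \o Q)%VF, (Q' \o tw)%VF; split=> [z|z|k z].
  - by rewrite !lfunS QQ' twK.
  - by rewrite !lfunS twK Q'Q.
  (* [size (enum 'I_n) = n], so the total sign is [c * c] *)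
  rewrite !lfunS QL ?mem_enum // size_enum_ord -/c cc scale1r.
  rewrite -[in LHS](twK (Q z)) -twT ?twK //.
  by move=> y; rewrite (par_cl ce') opprK.
elim: (enum 'I_n) (enum_uniq 'I_n) => [_|k l IH].
  by exists \1%VF, \1%VF; split => *; rewrite !lfunS // scale1r.
case/andP => kl /IH [Q [Q' [QQ' Q'Q QL QR QI]]].
(* [q k] squares to 2 *)
exists (q k \o Q)%VF, (2^-1 *: (Q' \o q k))%VF; split.
- by move=> z; rewrite !(comp_lfunE, scale_lfunE) lfunZ QQ' lfunZ qq scalerA
    mulVf ?scale1r ?pnatr_eq0.
- by move=> z; rewrite !(comp_lfunE, scale_lfunE) qq lfunZ Q'Q scalerA
    mulVf ?scale1r ?pnatr_eq0.
- move=> i z; rewrite inE negb_or => /andP[ik il].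
  rewrite !(comp_lfunE, scale_lfunE) QL // lfunZ.
  by rewrite qL 1?eq_sym //= exprS mulN1r scalerN scaleNr.
- move=> i z; rewrite inE negb_or => /andP[ik il].
  rewrite !(comp_lfunE, scale_lfunE) QR // lfunZ.
  by rewrite qR 1?eq_sym //= exprS mulN1r scalerN scaleNr.
move=> i z; rewrite inE !(comp_lfunE, scale_lfunE); have [-> _|ik /= il] := eqVneq i k.
  rewrite QL // lfunZ qLk scalerA mulrC /=; congr (_ *: _).
  by rewrite !exprS !mulN1r opprK.
rewrite QI // lfunZ qR 1?eq_sym // scalerN -scaleNr /=.
by rewrite [in RHS]exprS mulN1r mulrN.
Qed.

End Swap.

(** On [X (x) X' (x) M] the families [E (x) 1 (x) w] and [1 (x) E' (x) w] are
    conjugate; the first makes this space [dim X'] copies of [X (x) M], the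
    second [dim X] copies of [X' (x) M]. *)
Lemma dim_intertw_clifford_tensor n X X' (e : 'I_n -> 'End(X)) (s : 'End(X))
    (e' : 'I_n -> 'End(X')) (s' : 'End(X')) M Y I (b : I -> 'I_n -> F)
    (E : I -> 'End(X)) (E' : I -> 'End(X')) (w : I -> 'End(M)) (T : I -> 'End(Y)) :
  clifford_ops e s -> clifford_ops e' s' ->
  (forall i x, E i x = \sum_k b i k *: e k x) ->
  (forall i x, E' i x = \sum_k b i k *: e' k x) ->
  (\dim {:X'} * \dim (intertw T (fun i => tmap (E i) (w i))))%N =
  (\dim {:X} * \dim (intertw T (fun i => tmap (E' i) (w i))))%N.
Proof.
move=> ce ce' EE EE'; have [Q [Q' [QQ' Q'Q Qe]]] := clifford_swap ce ce'.
have tE (z : tensor X X') i : tmap (E i) \1 z = \sum_k b i k *: tmap (e k) \1 z.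
  transitivity ((\sum_k b i k *: (tmap (e k) \1 : 'End(tensor X X')))%VF z).
    apply: tensor_lfun_ext => x y; rewrite !lfunS !tmapE -tensrE EE lfun_sum.
    by apply: eq_bigr => k _; rewrite lfunZ !lfunS tmapE tensrE lfunS.
  by rewrite !lfunS; apply: eq_bigr => k _; rewrite lfunS.
have tE' (z : tensor X X') i : tmap \1 (E' i) z = \sum_k b i k *: tmap \1 (e' k) z.
  transitivity ((\sum_k b i k *: (tmap \1 (e' k) : 'End(tensor X X')))%VF z).
    apply: tensor_lfun_ext => x y; rewrite !lfunS !tmapE -tenslE EE' lfun_sum.
    by apply: eq_bigr => k _; rewrite lfunZ !lfunS tmapE tenslE lfunS.
  by rewrite !lfunS; apply: eq_bigr => k _; rewrite lfunS.
pose W := tensor (tensor X X') M.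
pose T1 i : 'End(W) := tmap (tmap (E i) \1) (w i).
pose T2 i : 'End(W) := tmap (tmap \1 (E' i)) (w i).
have <- : \dim (intertw T T1) =
    (\dim {:X'} * \dim (intertw T (fun i => tmap (E i) (w i))))%N.
  apply: (dim_intertw_copiesr _
    (i := fun q => tmap (tensr X (vbasis {:X'})`_q) \1)
    (p := fun q => tmap (contrr X q) \1)).
  - move=> q r z; rewrite tmap_comp.
    have -> : (contrr X q \o tensr X (vbasis {:X'})`_r)%VF =
       if q == r then \1%VF else 0.
      apply/lfunP => x; rewrite lfunS contrr_tensr.
      by case: eqP; rewrite lfunS.
    rewrite comp_lfun1l; case: eqP => _; first exact: tmap11.
    have -> : 0 = (0 : 'End(tensor X M)) z by rewrite zero_lfunE.
    apply: tensor_lfun_ext => x y.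
    by rewrite tmapE !lfunS tens0l.
  - move=> z; transitivity ((\sum_(q < \dim {:X'})
      (tmap (tensr X (vbasis {:X'})`_q) (\1 : 'End(M)) \o tmap (contrr X q) \1))%VF z).
      by rewrite !lfunS; apply: eq_bigr => q _; rewrite lfunS.
    rewrite -[RHS]id_lfunE; apply: tensor_lfun_ext => p x; rewrite !lfunS.
    rewrite -[in RHS](sum_tensr p) -[RHS]tensrE lfun_sum; apply: eq_bigr => q _.
    by rewrite !lfunS !tmapE !lfunS [RHS]tensrE.
  - move=> q i z; rewrite !tmap_comp; apply: tmap_eq => x; rewrite !lfunS //.
    by rewrite !tensrE tmapE lfunS.
  move=> q i z; rewrite !tmap_comp; apply: tmap_eq => x; rewrite !lfunS //.
  rewrite -[LHS]comp_lfunE -[RHS]comp_lfunE; apply: tensor_lfun_ext => y y'.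
  by rewrite !lfunS tmapE !contrrE lfunS lfunZ.
have <- : \dim (intertw T T2) =
    (\dim {:X} * \dim (intertw T (fun i => tmap (E' i) (w i))))%N.
  apply: (dim_intertw_copiesr _
    (i := fun q => tmap (tensl X' (vbasis {:X})`_q) \1)
    (p := fun q => tmap (contrl X' q) \1)).
  - move=> q r z; rewrite tmap_comp.
    have -> : (contrl X' q \o tensl X' (vbasis {:X})`_r)%VF =
       if q == r then \1%VF else 0.
      apply/lfunP => x; rewrite lfunS contrl_tensl.
      by case: eqP; rewrite lfunS.
    rewrite comp_lfun1l; case: eqP => _; first exact: tmap11.
    have -> : 0 = (0 : 'End(tensor X' M)) z by rewrite zero_lfunE.
    apply: tensor_lfun_ext => x y.
    by rewrite tmapE !lfunS tens0l.
  - move=> z; transitivity ((\sum_(q < \dim {:X})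
      (tmap (tensl X' (vbasis {:X})`_q) (\1 : 'End(M)) \o tmap (contrl X' q) \1))%VF z).
      by rewrite !lfunS; apply: eq_bigr => q _; rewrite lfunS.
    rewrite -[RHS]id_lfunE; apply: tensor_lfun_ext => p x; rewrite !lfunS.
    rewrite -[in RHS](sum_tensl p) -[RHS]tensrE lfun_sum; apply: eq_bigr => q _.
    by rewrite !lfunS !tmapE !lfunS [RHS]tensrE.
  - move=> q i z; rewrite !tmap_comp; apply: tmap_eq => x; rewrite !lfunS //.
    by rewrite !tenslE tmapE lfunS.
  move=> q i z; rewrite !tmap_comp; apply: tmap_eq => x; rewrite !lfunS //.
  rewrite -[LHS]comp_lfunE -[RHS]comp_lfunE; apply: tensor_lfun_ext => y y'.
  by rewrite !lfunS tmapE !contrlE lfunS lfunZ.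
apply: (dim_intertw_isor _ (g := tmap Q \1) (h := tmap Q' \1)).
- move=> z; rewrite tmap_comp -[RHS]tmap11; apply: tmap_eq => x.
    by rewrite !lfunS.
  by rewrite !lfunS.
- move=> z; rewrite tmap_comp -[RHS]tmap11; apply: tmap_eq => x.
    by rewrite !lfunS.
  by rewrite !lfunS.
move=> i z; rewrite !tmap_comp; apply: tmap_eq => x; rewrite !lfunS //.
rewrite tE tE' lfun_sum; apply: eq_bigr => k _.
by rewrite lfunZ Qe.
Qed.

End TwistSwap.

(** * Parity operators and ordinary homomorphisms *)

Section Parity.
Variables (F : numFieldType) (V : vectType F) (P : bool -> {vspace V}).
Hypotheses (PD : (P false + P true = fullv)%VS) (PI : (P false :&: P true = 0)%VS).

(** The operator [parop] is kept behind an opaque proof so that rules for sums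
    of linear maps do not unfold it. *)
Fact parop_subproof : {f : 'End(V) |
  f = (daddv_pi (P false) (P true) - daddv_pi (P true) (P false))%VF}.
Proof. by eexists. Qed.

Definition parop : 'End(V) := sval parop_subproof.

Lemma paropE q x : x \in P q -> parop x = (-1) ^+ q *: x.
Proof.
have PI' : (P true :&: P false = 0)%VS by rewrite capvC.
have piE U U' (y : V) : (U :&: U' = 0)%VS -> y \in U -> daddv_pi U' U y = 0.
  move=> UI yU; apply: (@addrI _ y); rewrite addr0 -[in LHS](daddv_pi_id UI yU).
  rewrite (daddv_pi_id UI yU) -{1}(daddv_pi_id UI yU) daddv_pi_add //.
  exact: subvP (addvSl _ _) _ yU.
case: q => xq; rewrite /parop (svalP parop_subproof) !lfunS.
  by rewrite (daddv_pi_id PI' xq) (piE _ _ _ PI' xq) sub0r scaleN1r.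
by rewrite (daddv_pi_id PI xq) (piE _ _ _ PI xq) subr0 scale1r.
Qed.

Lemma par_split x : exists x0 x1,
  [/\ x0 \in P false, x1 \in P true & x = x0 + x1].
Proof.
have: x \in fullv by rewrite memvf.
by rewrite -PD => /memv_addP[x0 P0 [x1 P1 ->]]; exists x0, x1.
Qed.

Lemma paropK x : parop (parop x) = x.
Proof.
have [x0 [x1 [P0 P1 ->]]] := par_split x.
by rewrite !(lfunD, paropE P0, paropE P1, lfunZ) !scalerA -!expr2 !sqrr_sign !scale1r.
Qed.

Lemma mem_par q x : x \in P q <-> parop x = (-1) ^+ q *: x.
Proof.
split=> [|xx]; first exact: paropE.
have [x0 [x1 [P0 P1 xE]]] := par_split x.
move: xx; rewrite xE lfunD (paropE P0) (paropE P1) scalerDr.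
have h (y : V) : (y + y == 0) = (y == 0).
  by rewrite -mulr2n -scaler_nat scaler_eq0 pnatr_eq0.
case: q; rewrite !(expr1, expr0, scale1r, scaleN1r).
  by move/addIr/eqP; rewrite -subr_eq0 opprK h => /eqP ->; rewrite add0r.
by move/addrI/esym/eqP; rewrite -subr_eq0 opprK h => /eqP ->; rewrite addr0.
Qed.

End Parity.

Section Supermodules.
Variable F : numFieldType.
Implicit Types (A : superalgebra F) (M N : vectType F).

Definition apar A : 'End(A) := parop (spar A).
Definition smpar A M (X : supermodule A M) : 'End(M) := parop (mpar X).

Lemma aparK A a : apar A (apar A a) = a.
Proof. by apply: paropK; [apply: spar_add|apply: spar_cap]. Qed.

Lemma aparE A q a : a \in spar A q -> apar A a = (-1) ^+ q *: a.
Proof. exact/paropE/spar_cap. Qed.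

Lemma smparK A M (X : supermodule A M) m : smpar X (smpar X m) = m.
Proof. by apply: paropK; [apply: mpar_add|apply: mpar_cap]. Qed.

Lemma smparE A M (X : supermodule A M) q m :
  m \in mpar X q -> smpar X m = (-1) ^+ q *: m.
Proof. exact/paropE/mpar_cap. Qed.

Lemma mem_mpar A M (X : supermodule A M) q m :
  m \in mpar X q <-> smpar X m = (-1) ^+ q *: m.
Proof. by apply: mem_par; [apply: mpar_add|apply: mpar_cap]. Qed.

Lemma spar_split A (a : A) : exists a0 a1,
  [/\ a0 \in spar A false, a1 \in spar A true & a = a0 + a1].
Proof. exact/par_split/spar_add. Qed.

Lemma mpar_split A M (X : supermodule A M) m : exists m0 m1,
  [/\ m0 \in mpar X false, m1 \in mpar X true & m = m0 + m1].
Proof. exact/par_split/mpar_add. Qed.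

Lemma signM (q p : bool) : (-1) ^+ (q (+) p) = (-1) ^+ q * (-1) ^+ p :> F.
Proof. by case: q; case: p; rewrite /= ?expr1 ?expr0 ?mulr1 ?mulrNN ?mul1r. Qed.

Lemma aparM A a b : apar A (a * b) = apar A a * apar A b.
Proof.
have [a0 [a1 [P0 P1 ->]]] := spar_split a.
have [b0 [b1 [Q0 Q1 ->]]] := spar_split b.
have h q p x y : x \in spar A q -> y \in spar A p ->
    apar A (x * y) = apar A x * apar A y.
  move=> xq yp; rewrite (aparE (sparM xq yp)) (aparE xq) (aparE yp).
  by rewrite -scalerAl -scalerAr scalerA signM.
by rewrite !(mulrDl, mulrDr, lfunD) (h _ _ _ _ P0 Q0) (h _ _ _ _ P0 Q1)
  (h _ _ _ _ P1 Q0) (h _ _ _ _ P1 Q1).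
Qed.

Lemma mact_smpar A M (X : supermodule A M) q a m :
  a \in spar A q -> X a (smpar X m) = (-1) ^+ q *: smpar X (X a m).
Proof.
move=> aq; have [m0 [m1 [P0 P1 ->]]] := mpar_split X m.
have h p y : y \in mpar X p -> X a (smpar X y) = (-1) ^+ q *: smpar X (X a y).
  move=> yp; rewrite (smparE (mact_par aq yp)) (smparE yp) lfunZ scalerA signM.
  by rewrite mulrA -expr2 sqrr_sign mul1r.
by rewrite !lfunD (h _ _ P0) (h _ _ P1) scalerDr.
Qed.

Lemma mact_add A M (X : supermodule A M) a b m : X (a + b) m = X a m + X b m.
Proof. by rewrite linearD lfunS. Qed.

Lemma mact_scale A M (X : supermodule A M) c a m : X (c *: a) m = c *: X a m.
Proof. by rewrite linearZ lfunS. Qed.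

(** Linear maps commuting with the action, without Koszul signs. *)
Definition uhom A M N (X : supermodule A M) (Y : supermodule A N) :
  {vspace 'Hom(M, N)} := intertw (fun a => X a) (fun a => Y a).

Lemma mem_uhom_homog A M N (X : supermodule A M) (Y : supermodule A N)
    (f : 'Hom(M, N)) :
  (forall q a m, a \in spar A q -> f (X a m) = Y a (f m)) -> f \in uhom X Y.
Proof.
move=> h; apply/mem_intertw => a m.
have [a0 [a1 [P0 P1 ->]]] := spar_split a.
by rewrite !mact_add lfunD (h _ _ _ P0) (h _ _ _ P1).
Qed.

Section Shom.
Variables (A : superalgebra F) (M N : vectType F).
Variables (X : supermodule A M) (Y : supermodule A N).
Let s := smpar X.
Let s' := smpar Y.

Lemma hom_par_split (f : 'Hom(M, N)) : exists f0 f1 : 'Hom(M, N),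
  [/\ forall m, f0 m = 2^-1 *: (f m + s' (f (s m))),
      forall m, f1 m = 2^-1 *: (f m - s' (f (s m))),
      forall m, f0 (s m) = s' (f0 m),
      forall m, f1 (s m) = - s' (f1 m) & f = f0 + f1].
Proof.
exists (2^-1 *: (f + (s' \o f \o s)))%VF, (2^-1 *: (f - (s' \o f \o s)))%VF.
split.
- by move=> m; rewrite !lfunS.
- by move=> m; rewrite !lfunS.
- by move=> m; rewrite !lfunS !lfunZ lfunD /s /s' !smparK addrC.
- by move=> m; rewrite !lfunS !lfunZ lfunD lfunN /s /s' !smparK -scalerN opprB.
by rewrite -scalerDr addrACA subrr addr0 scale_half.
Qed.

Lemma homog_par p (f : 'Hom(M, N)) :
  (forall q m, m \in mpar X q -> f m \in mpar Y (p (+) q)) <->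
  (forall m, f (s m) = (-1) ^+ p *: s' (f m)).
Proof.
split=> h.
  move=> m; have [m0 [m1 [P0 P1 ->]]] := mpar_split X m.
  have k q y : y \in mpar X q -> f (s y) = (-1) ^+ p *: s' (f y).
    move=> yq; rewrite /s /s' (smparE yq) (smparE (h _ _ yq)) lfunZ scalerA signM.
    by rewrite mulrA -expr2 sqrr_sign mul1r.
  by rewrite !lfunD (k _ _ P0) (k _ _ P1) scalerDr.
move=> q m mq; apply/mem_mpar; have := h m.
rewrite /s (smparE mq) lfunZ => /(congr1 (fun y => (-1) ^+ p *: y)).
by rewrite !scalerA -expr2 sqrr_sign scale1r -signM => ->.
Qed.

Lemma shom_homog_even (f : 'Hom(M, N)) :
  shom_homog X Y false f <-> (forall m, f (s m) = s' (f m)) /\ f \in uhom X Y.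
Proof.
split=> [[/homog_par fs fa]|[fs /mem_intertw fa]]; split.
- by move=> m; rewrite fs scale1r.
- by apply: mem_uhom_homog => q a m aq; rewrite (fa _ _ aq) scale1r.
- by apply/homog_par => m; rewrite fs scale1r.
by move=> q a aq m; rewrite fa scale1r.
Qed.

Lemma shom_homog_odd (f : 'Hom(M, N)) :
  shom_homog X Y true f <->
  (forall m, f (s m) = - s' (f m)) /\ (f \o s)%VF \in uhom X Y.
Proof.
split=> [[/homog_par fs fa]|[fs /mem_intertw fa]]; split.
- by move=> m; rewrite fs scaleN1r.
- apply: mem_uhom_homog => q a m aq; rewrite !lfunS.
  have := mact_smpar X m aq => /(congr1 (fun y => (-1) ^+ q *: y)).
  rewrite scalerA -expr2 sqrr_sign scale1r => <-.
  by rewrite lfunZ (fa _ _ aq) scalerA -expr2 sqrr_sign scale1r.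
- by apply/homog_par => m; rewrite fs scaleN1r.
move=> q a aq m; have := fa a (s m); rewrite !lfunS /s smparK => <-.
rewrite (mact_smpar X m aq).
by rewrite !lfunZ smparK scalerA -expr2 sqrr_sign scale1r.
Qed.

(** Fixes the even maps and sends an odd map [f] to [f s]. *)
Definition unsign : 'End('Hom(M, N)) :=
  (2^-1 *: (sandwich \1 \1 + sandwich s' s + sandwich \1 s - sandwich s' \1))%VF.

Lemma unsignE (f : 'Hom(M, N)) m :
  unsign f m = 2^-1 *: (f m + s' (f (s m)) + f (s m) - s' (f m)).
Proof. by rewrite !(lfunS, sandwichE). Qed.

Lemma unsign_even (f : 'Hom(M, N)) : (forall m, f (s m) = s' (f m)) -> unsign f = f.
Proof.
move=> fs; apply/lfunP => m.
by rewrite unsignE !fs /s' smparK addrK scale_half.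
Qed.

Lemma unsign_odd (f : 'Hom(M, N)) : (forall m, f (s m) = - s' (f m)) ->
  unsign f = (f \o s)%VF.
Proof.
move=> fs; apply/lfunP => m; rewrite unsignE !fs lfunN /s' smparK subrr add0r.
by rewrite -/s' scale_half lfunS fs.
Qed.

Lemma unsignK (f : 'Hom(M, N)) : unsign (unsign f) = f.
Proof.
have [f0 [f1 [_ _ E0 E1 ->]]] := hom_par_split f.
rewrite !lfunD (unsign_even E0) (unsign_odd E1) (unsign_even E0) unsign_odd.
  by congr (_ + _); apply/lfunP => m; rewrite !lfunS /s smparK.
by move=> m; rewrite !lfunS E1.
Qed.

Lemma uhom_conj (f : 'Hom(M, N)) : f \in uhom X Y -> (s' \o f \o s)%VF \in uhom X Y.
Proof.
move/mem_intertw => fa; apply: mem_uhom_homog => q a m aq; rewrite !lfunS.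
have h := mact_smpar X m aq; have h' := mact_smpar Y (f (s m)) aq.
move: h => /(congr1 (fun y => (-1) ^+ q *: y)).
by rewrite scalerA -expr2 sqrr_sign scale1r => <-; rewrite !lfunZ fa h'.
Qed.

Lemma shom_sub (W : {vspace 'Hom(M, N)}) :
  (forall p f, shom_homog X Y p f -> f \in W) -> (shom X Y <= W)%VS.
Proof.
move=> h; apply/subvP => f /vspanP[l lP]; apply/subvP/span_subvP => g /lP[p].
exact: h.
Qed.

Lemma shom_unsign (f : 'Hom(M, N)) : f \in uhom X Y -> unsign f \in shom X Y.
Proof.
move=> fa.
have [f0 [f1 [D0 D1 E0 E1 fE]]] := hom_par_split f.
have cfa := uhom_conj fa.
have f0a : f0 \in uhom X Y.
  suff -> : f0 = 2^-1 *: (f + (s' \o f \o s)%VF) by rewrite memvZ // memvD.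
  by apply/lfunP => m; rewrite D0 !lfunS.
have f1a : f1 \in uhom X Y.
  suff -> : f1 = 2^-1 *: (f - (s' \o f \o s)%VF) by rewrite memvZ // memvB.
  by apply/lfunP => m; rewrite D1 !lfunS.
rewrite fE lfunD (unsign_even E0) (unsign_odd E1) memvD //; apply: mem_vspan.
  by exists false; apply/shom_homog_even.
exists true; apply/shom_homog_odd; split=> [m|]; first by rewrite !lfunS E1.
suff -> : ((f1 \o s) \o s)%VF = f1 by [].
by apply/lfunP => m; rewrite !lfunS /s smparK.
Qed.

(** An odd super homomorphism anticommutes with odd elements, and so does [s];
    hence [unsign] exchanges super and ordinary homomorphisms. *)
Lemma dim_shom : \dim (shom X Y) = \dim (uhom X Y).
Proof.
apply: (dim_bij (f := unsign) (g := unsign)) => [|f fa|f _|f _].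
- suff h : (shom X Y <= unsign @^-1: uhom X Y)%VS.
    by move=> f /(subvP h); rewrite -memv_preim.
  apply: shom_sub => -[] f; rewrite -memv_preim.
    by move=> /shom_homog_odd[fs fa]; rewrite unsign_odd.
  by move=> /shom_homog_even[fs fa]; rewrite unsign_even.
- exact: (shom_unsign fa).
- exact: unsignK.
exact: unsignK.
Qed.

End Shom.

(** The elements with which [f] commutes form a subalgebra. *)
Lemma uhom_gen A M N (X : supermodule A M) (Y : supermodule A N)
    (U : {vspace A}) (f : 'Hom(M, N)) :
  agenv U = fullv -> (forall a m, a \in U -> f (X a m) = Y a (f m)) ->
  f \in uhom X Y.
Proof.
move=> Ugen fU; pose P (a : A) := forall m, f (X a m) = Y a (f m).
have memP : forall a, a \in vspan P <-> P a.
  apply: (mem_vspan_closed (P := P)) => [m|c a b Pa Pb m].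
    by rewrite !linear0 !zero_lfunE linear0.
  by rewrite !mact_add !mact_scale lfunD lfunZ Pa Pb.
have sub : (agenv U <= vspan P)%VS.
  apply: agenv_sub_modl.
    apply/subvP => _ /vlineP[c ->]; apply/memP => m.
    by rewrite !mact_scale lfunZ !mact1.
  apply/prodvP => a b aU /memP Pb; apply/memP => m.
  by rewrite !mactM fU // Pb.
apply/mem_intertw => a; apply/memP; apply: (subvP sub).
by rewrite Ugen memvf.
Qed.

(** An odd isomorphism becomes an ordinary one after composition with the parity
    operator. *)
Lemma dim_uhom_siso A M M' N (X : supermodule A M) (X' : supermodule A M')
    (Z : supermodule A N) :
  siso X X' -> \dim (uhom X Z) = \dim (uhom X' Z).
Proof.
case=> f [p fp] bf.
have [g [bg /mem_intertw ga]] : exists g : 'Hom(M, M'), bijective g /\ g \in uhom X X'.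
  case: p fp => [/shom_homog_odd|/shom_homog_even] [fs fa]; last by exists f.
  exists (f \o smpar X)%VF; split=> //.
  apply: (eq_bij (f := f \o smpar X)) => [|m]; last by rewrite comp_lfunE.
  by apply: bij_comp => //; exists (smpar X) => m; rewrite smparK.
have kg : lker g == 0%VS by apply/lker0P; apply: bij_inj.
have gK := lker0_lfunK kg.
have [h hg gh] := bg.
apply: (dim_intertw_isol _ (g := g) (h := g^-1%VF)) => // x.
by rewrite -(gh x) gK.
Qed.

Lemma is_submodule_par A M (X : supermodule A M) (S : {vspace M}) :
  (forall a m, m \in S -> X a m \in S) -> (forall m, m \in S -> smpar X m \in S) ->
  is_submodule X S.
Proof.
move=> Sa Ss; split=> //; apply/eqP; rewrite eqEsubv; apply/andP; split.
  apply/subvP => m mS; have sS := Ss m mS.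
  have -> : m = 2^-1 *: (m + smpar X m) + 2^-1 *: (m - smpar X m).
    by rewrite -scalerDr addrACA subrr addr0 scale_half.
  apply: memv_add; apply: memvZ; rewrite memv_cap; apply/andP; split.
  - by rewrite memvD.
  - by apply/mem_mpar; rewrite lfunD smparK addrC scale1r.
  - by rewrite memvB.
  by apply/mem_mpar; rewrite lfunD lfunN smparK scaleN1r opprB.
by rewrite subv_add !capvSl.
Qed.

(** For [f] of parity p the right-hand side is [(-1)^p Y (e i) (f m)], so the
    condition states the sign rule for odd generators; it is stable under
    conjugation by the parity operators, hence passes to the homogeneous parts
    of [f]. *)
Lemma mem_shom_gen A M N (X : supermodule A M) (Y : supermodule A N)
    (I : Type) (e : I -> A) :
  (forall i, e i \in spar A true) ->
  (forall f : 'Hom(M, N), (forall i m, f (X (e i) m) = Y (e i) (f m)) ->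
     f \in uhom X Y) ->
  forall f : 'Hom(M, N), f \in shom X Y <->
    forall i m, f (X (e i) m) = Y (e i) (smpar Y (f (smpar X m))).
Proof.
move=> eo gen f; split.
  pose P (f : 'Hom(M, N)) := forall i m,
    f (X (e i) m) = Y (e i) (smpar Y (f (smpar X m))).
  have memP : forall g, g \in vspan P <-> P g.
    apply: (mem_vspan_closed (P := P)) => [i m|c g h Pg Ph i m].
      by rewrite !lfunS !linear0.
    by rewrite !lfunS !(lfunD, lfunZ) Pg Ph.
  move=> fs; apply/memP; move: f fs; apply/subvP; apply: shom_sub => p f fp.
  apply/memP => i m; case: fp => /homog_par fs fa.
  by rewrite fs lfunZ smparK lfunZ (fa _ _ (eo i)) andbT.
move=> fe.
have eX i m : X (e i) (smpar X m) = - smpar X (X (e i) m).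
  by rewrite (mact_smpar X m (eo i)) scaleN1r.
have eY i m : Y (e i) (smpar Y m) = - smpar Y (Y (e i) m).
  by rewrite (mact_smpar Y m (eo i)) scaleN1r.
have fe' i m : smpar Y (f (smpar X (X (e i) m))) = Y (e i) (f m).
  by rewrite -[smpar X _]opprK -eX !lfunN fe smparK -eY smparK.
have [f0 [f1 [D0 D1 E0 E1 ->]]] := hom_par_split X Y f.
apply: memvD; apply: mem_vspan.
  exists false; apply/shom_homog_even; split=> //; apply: gen => i m.
  by rewrite !D0 fe fe' lfunZ lfunD addrC.
exists true; apply/shom_homog_odd; split=> //; apply: gen => i m.
rewrite !lfunS -[smpar X (X _ _)]opprK -eX lfunN !D1 fe fe' lfunZ lfunD lfunN.
by rewrite -scalerN opprB.
Qed.

End Supermodules.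

(** * Schur's lemma *)

Section Schur.
Variables (F : numClosedFieldType) (A : superalgebra F) (M : vectType F).
Variable X : supermodule A M.
Hypothesis sX : simple_smod X.

Lemma lfun_eigenvector (f : 'End(M)) : (0 < \dim {:M})%N ->
  exists (c : F) (v : M), v != 0 /\ f v = c *: v.
Proof.
move=> M0; have bM := vbasisP {:M}.
have [c] := eigenvalue_closed (passmx.mxof (vbasis {:M}) (vbasis {:M}) f) M0.
case/eigenvalueP => v vf v0; exists c, (passmx.vecof (vbasis {:M}) v); split.
  by rewrite passmx.vecof_eq0.
rewrite (passmx.hom_vecof _ bM) vf /passmx.vecof scaler_sumr.
by apply: eq_bigr => i _; rewrite mxE scalerA.
Qed.

(** Eigenspaces of an even homomorphism are graded submodules. *)
Lemma schur_even (f : 'End(M)) :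
  f \in uhom X X -> (forall m, f (smpar X m) = smpar X (f m)) ->
  exists c : F, forall m, f m = c *: m.
Proof.
case: sX => /eqP; rewrite -lt0n => M0 simX /mem_intertw fa fs.
have [c [v [v0 fv]]] := lfun_eigenvector f M0; exists c => m.
have memK x : (x \in lker (f - c *: \1)%VF) = (f x == c *: x).
  by rewrite memv_ker !lfunS subr_eq0.
have [] := simX (lker (f - c *: \1)%VF).
- apply: is_submodule_par => [a|] x; rewrite !memK => /eqP fx.
    by rewrite fa fx lfunZ.
  by rewrite fs fx lfunZ.
- move=> K0; have : v \in lker (f - c *: \1)%VF by rewrite memK fv.
  by rewrite K0 memv0 (negPf v0).
by move=> Kf; apply/eqP; rewrite -memK Kf memvf.
Qed.

Lemma schur_odd (g : 'End(M)) :
  g \in uhom X X -> (forall m, g (smpar X m) = - smpar X (g m)) -> g != 0 ->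
  forall m, g m = 0 -> m = 0.
Proof.
case: sX => _ simX /mem_intertw ga gs g0 m gm.
have [] := simX (lker g).
- apply: is_submodule_par => [a|] x; rewrite !memv_ker => /eqP gx.
    by rewrite ga gx linear0.
  by rewrite gs gx linear0 oppr0.
- by move=> K0; apply/eqP; rewrite -memv0 -K0 memv_ker gm.
move=> Kf; case/eqP: g0; apply/lfunP => x; rewrite zero_lfunE.
by apply/eqP; rewrite -memv_ker Kf memvf.
Qed.

(** The even part is the scalars. If [g] is a nonzero odd homomorphism, then
    composition with [g] embeds the odd part into the even part. *)
Lemma dim_uhom_simple : (0 < \dim (uhom X X) <= 2)%N.
Proof.
have M0 : (0 < \dim {:M})%N by rewrite lt0n; apply/eqP; case: sX.
apply/andP; split.
  rewrite lt0n dimv_eq0; apply/eqP => h.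
  have : (\1%VF : 'End(M)) \in uhom X X.
    by apply/mem_intertw => a m; rewrite !id_lfunE.
  rewrite h memv0 => /eqP/lfunP h1.
  have [c [v [/eqP v0 _]]] := lfun_eigenvector \1%VF M0.
  by apply: v0; have := h1 v; rewrite !lfunS.
pose s := smpar X.
pose Ev := fixv (sandwich s s).
have memE f : f \in Ev <-> forall m, f (s m) = s (f m).
  rewrite mem_fixv; split=> [/eqP/lfunP h m|h].
    by have := h (s m); rewrite sandwichE /s smparK.
  by apply/eqP/lfunP => m; rewrite sandwichE h /s smparK.
pose Od := fixv (- sandwich s s).
have memO f : f \in Od <-> forall m, f (s m) = - s (f m).
  rewrite mem_fixv; split=> [/eqP/lfunP h m|h].
    by have := h (s m); rewrite !lfunS sandwichE /s smparK => <-.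
  by apply/eqP/lfunP => m; rewrite !lfunS sandwichE h /s lfunN smparK opprK.
have EvE : (uhom X X :&: Ev <= <[\1%VF : 'End(M)]>)%VS.
  apply/subvP => f; rewrite memv_cap => /andP[fa /memE fs].
  have [c fc] := schur_even fa fs; apply/vlineP; exists c.
  by apply/lfunP => m; rewrite fc !lfunS.
have dE : (\dim (uhom X X :&: Ev) <= 1)%N.
  by apply: leq_trans (dimvS EvE) _; rewrite dim_vline leq_b1.
have dO : (\dim (uhom X X :&: Od) <= 1)%N.
  have [->|] := eqVneq (uhom X X :&: Od)%VS 0%VS; first by rewrite dimv0.
  rewrite -vpick0; set g := vpick _ => g0.
  have := memv_pick (uhom X X :&: Od); rewrite -/g memv_cap => /andP[ga /memO gs].
  apply: leq_trans dE.
  apply: (dim_le_inj (f := sandwich g \1)) => f; rewrite !memv_cap => /andP[fa /memO fs].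
    apply/andP; split.
      apply/mem_intertw => a m; rewrite !sandwichE !lfunS.
      by move/mem_intertw: ga => ga; move/mem_intertw: fa => fa; rewrite fa ga.
    by apply/memE => m; rewrite !sandwichE !lfunS fs lfunN gs opprK.
  move=> /lfunP gf; apply/lfunP => m; rewrite zero_lfunE.
  apply: (schur_odd ga gs g0).
  by have := gf m; rewrite sandwichE !lfunS.
apply: leq_trans (_ : (\dim (uhom X X :&: Ev + uhom X X :&: Od) <= 2)%N).
  apply: dimvS; apply/subvP => f fa.
  have [f0 [f1 [D0 D1 E0 E1 fE]]] := hom_par_split X X f.
  have cfa := uhom_conj fa.
  rewrite fE memv_add // memv_cap; apply/andP; split; try exact/memE; try exact/memO.
    suff -> : f0 = 2^-1 *: (f + (s \o f \o s)%VF) by rewrite memvZ // memvD.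
    by apply/lfunP => m; rewrite D0 !lfunS.
  suff -> : f1 = 2^-1 *: (f - (s \o f \o s)%VF) by rewrite memvZ // memvB.
  by apply/lfunP => m; rewrite D1 !lfunS.
apply: leq_trans (dimv_add_leqif _ _) _.
by rewrite (leq_add dE dO).
Qed.

End Schur.

(** * Clifford, spin and Hecke-Clifford modules *)

Section Generators.
Variable F : numFieldType.
Implicit Types (A B T : superalgebra F) (M N : vectType F).

Lemma uhom_mem A M N (X : supermodule A M) (Y : supermodule A N)
    (f : 'Hom(M, N)) :
  f \in uhom X Y <-> forall a m, f (X a m) = Y a (f m).
Proof. exact: mem_intertw. Qed.

Lemma uhom_span_gen A (I : finType) (t : I -> A) M N
    (X : supermodule A M) (Y : supermodule A N) :
  agenv <<[seq t i | i : I]>>%VS = fullv ->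
  uhom X Y = intertw (fun i => X (t i)) (fun i => Y (t i)).
Proof.
move=> tgen; apply/vspaceP => f; apply/idP/idP.
  by move/uhom_mem => h; apply/mem_intertw => i m; rewrite h.
move/mem_intertw => h; apply: (uhom_gen tgen) => a m.
move=> /(@coord_span _ _ _ (in_tuple _)) ->.
rewrite !linear_sum !sum_lfunE lfun_sum; apply: eq_bigr => i _ /=.
rewrite !mact_scale lfunZ; congr (_ *: _).
by have /imageP[l _ ->] := mem_nth 0 (ltn_ord i).
Qed.

Lemma clifford_ops_smod A n (e : 'I_n -> A) M (X : supermodule A M) :
  (forall k, e k \in spar A true) -> (forall k, e k * e k = 1) ->
  (forall k l, k != l -> e k * e l = - (e l * e k)) ->
  clifford_ops (fun k => X (e k)) (smpar X).
Proof.
move=> eo ee eC; split.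
- exact: smparK.
- by move=> k m; rewrite (mact_smpar X m (eo k)) scaleN1r opprK.
- by move=> k m; rewrite -mactM ee mact1.
by move=> k l m kl; rewrite -!mactM eC // linearN opp_lfunE.
Qed.

End Generators.

Section RegularModule.
Variables (F : numFieldType) (A : superalgebra F).

Let act : {linear A -> 'End(A)} := @amull F A.

Let act1 m : act 1 m = m.
Proof. by rewrite lfunE /= mul1r. Qed.

Let actM a b m : act (a * b) m = act a (act b m).
Proof. by rewrite !lfunE /= mulrA. Qed.

Let act_par p q a m :
  a \in spar A p -> m \in spar A q -> act a m \in spar A (p (+) q).
Proof. by rewrite lfunE; apply: sparM. Qed.

Definition regular_smod : supermodule A A :=
  Supermodule (spar_add A) (spar_cap A) act1 actM act_par.

Lemma regular_smodE a m : regular_smod a m = a * m.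
Proof. by rewrite lfunE. Qed.

(** Endomorphisms of the regular left module are the right multiplications. *)
Lemma dim_uhom_regular : \dim (uhom regular_smod regular_smod) = \dim {:A}.
Proof.
symmetry; have lin1 : linear (fun f : 'End(A) => f 1) by move=> c f g; rewrite !lfunS.
have [ev evE] := lfun_exists lin1.
have RE a m : linfun (@amulr F A) a m = m * a by rewrite !lfunE.
apply: (dim_bij (f := linfun (@amulr F A)) (g := ev)).
- move=> a _; apply/uhom_mem => b m; rewrite !RE.
  by rewrite !regular_smodE mulrA.
- by move=> f _; rewrite memvf.
- by move=> a _; rewrite evE /= RE mul1r.
move=> f /uhom_mem fa; apply/lfunP => m; rewrite RE evE.
by rewrite -regular_smodE -fa regular_smodE mulr1.
Qed.

End RegularModule.

Section Assembly.
Variables (F : numClosedFieldType) (n : nat).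
Variables (Cl Hc Wm : superalgebra F) (e : 'I_n -> Cl) (t : 'I_n -> Wm).
Hypothesis eo : forall k, e k \in spar Cl true.
Hypothesis ee : forall k, e k * e k = 1.
Hypothesis eC : forall k l, k != l -> e k * e l = - (e l * e k).
Hypothesis egen : forall M N (X : supermodule Cl M) (Y : supermodule Cl N),
  uhom X Y = intertw (fun k => X (e k)) (fun k => Y (e k)).
Hypothesis ho : forall i, t i \in spar Wm true.
Hypothesis tgen : forall M N (X : supermodule Wm M) (Y : supermodule Wm N),
  uhom X Y = intertw (fun i => X (t i)) (fun i => Y (t i)).
Variables (j : salg_hom Cl Hc) (theta : salg_hom Wm Hc).
Hypothesis htheta : is_super_tensor j theta.

Lemma uhom_super_tensor M N (X : supermodule Hc M) (Y : supermodule Hc N) :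
  uhom X Y = (intertw (fun i => X (theta (t i))) (fun i => Y (theta (t i))) :&:
    intertw (fun k => X (j (e k))) (fun k => Y (j (e k))))%VS.
Proof.
apply/vspaceP => f; apply/idP/idP.
  move/uhom_mem => h; rewrite memv_cap; apply/andP.
  by split; apply/mem_intertw => i m; rewrite h.
rewrite memv_cap => /andP[f1 f2].
have {}f1 : f \in uhom (pullback theta X) (pullback theta Y) by rewrite tgen.
have {}f2 : f \in uhom (pullback j X) (pullback j Y) by rewrite egen.
move/uhom_mem: f1 => f1; move/uhom_mem: f2 => f2.
case: htheta => _ [g gE [g' _ gg']]; apply/uhom_mem => a m.
rewrite -(gg' a) (tens_basis (g' a)) lfun_sum !linear_sum !sum_lfunE lfun_sum.
apply: eq_bigr => i _; rewrite /= gE !mactM.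
by have := f2 ((g' a) i) (X (theta (vbasis {:Wm})`_i) m);
  have := f1 (vbasis {:Wm})`_i m; rewrite /= => -> ->.
Qed.

Lemma theta_par M (X : supermodule Hc M) i m :
  X (theta (t i)) (smpar X m) = - smpar X (X (theta (t i)) m).
Proof. by rewrite (mact_smpar X m (shf_par theta (ho i))) scaleN1r. Qed.

Lemma theta_cl M (X : supermodule Hc M) i k m :
  X (theta (t i)) (X (j (e k)) m) = - X (j (e k)) (X (theta (t i)) m).
Proof.
case: htheta => h _; rewrite -!mactM (h _ _ _ _ (eo k) (ho i)) scaleN1r.
by rewrite linearN opp_lfunE.
Qed.

Lemma clifford_ops_j M (X : supermodule Hc M) :
  clifford_ops (fun k => X (j (e k))) (smpar X).
Proof.
apply: clifford_ops_smod => [k|k|k l kl]; first exact: (shf_par j (eo k)).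
  by rewrite -rmorphM ee rmorph1.
by rewrite -!rmorphM eC // rmorphN.
Qed.

Lemma dim_uhom_hecke_clifford M N (X : supermodule Hc M) (Y : supermodule Hc N) :
  (2 ^ n * \dim (uhom X Y))%N =
  \dim (intertw (fun i => X (theta (t i))) (fun i => Y (theta (t i)))).
Proof.
rewrite uhom_super_tensor.
apply: (dim_clifford_intertw (clifford_ops_j X) (clifford_ops_j Y)).
- by move=> i k m; rewrite theta_cl.
- by move=> i k m; rewrite theta_cl.
by move=> i m; rewrite theta_par.
Qed.

(** [dim_clifford_hom] for the regular module reads [N dim Cl = (dim Cl)^2]. *)
Lemma dim_clifford_algebra : \dim {:Cl} = (2 ^ n)%N.
Proof.
have ce := clifford_ops_smod (regular_smod Cl) eo ee eC.
have := dim_clifford_hom ce ce.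
rewrite -egen dim_uhom_regular => /eqP; rewrite eqn_pmul2r => [/eqP -> //|].
rewrite lt0n dimv_eq0; apply/eqP => h.
have : (1 : Cl) \in fullv by rewrite memvf.
by rewrite h memv0 oner_eq0.
Qed.

(** Right multiplication, turned into a left action that supercommutes with left
    multiplication. The square root of -1 compensates the sign
    [(-1)^(|a| + |a e k|) = -1] in [r k (r k a)]. *)
Lemma right_clifford_ops : exists r : 'I_n -> 'End(Cl),
  (forall k a, r k a = 'i *: (apar Cl a * e k)) /\ clifford_ops r (apar Cl).
Proof.
have lin k : linear (fun a : Cl => 'i *: (apar Cl a * e k)).
  move=> c a b; rewrite lfunD lfunZ mulrDl scalerDr -scalerAl !scalerA.
  by rewrite mulrC.
pose r k := lfun_of (lin k).
have rE k a : r k a = 'i *: (apar Cl a * e k) by rewrite lfun_ofE.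
exists r; split=> //; clearbody r.
have ae k : apar Cl (e k) = - e k by rewrite (aparE (eo k)) scaleN1r.
have ii : 'i * 'i = -1 :> F by rewrite -expr2 sqrCi.
split.
- exact: aparK.
- by move=> k a; rewrite !rE lfunZ aparM ae mulrN scalerN.
- move=> k a; rewrite !rE lfunZ aparM aparK ae -scalerAl scalerA ii.
  by rewrite -mulrA mulNr ee mulrN1 scaleN1r opprK.
move=> k l a kl; rewrite !rE !lfunZ !aparM !aparK !ae -!scalerAl !scalerA ii.
by rewrite !mulrN !mulNr !scaleN1r !opprK -!mulrA (eC kl) mulrN opprK.
Qed.

Variables (U : vectType F) (mU : supermodule Cl U) (hU : simple_smod mU).

(** The left-hand side has an even 2-adic valuation, and [c] is 1 or 2, so the
    valuation of [c] has the parity of [n]. *)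
Lemma dim_simple_clifford : exists c,
  (\dim {:U} * \dim {:U})%N = (2 ^ n * c)%N /\ c = (odd n).+1.
Proof.
have ce := clifford_ops_smod mU eo ee eC.
have := dim_clifford_hom ce ce; rewrite -egen.
have := dim_uhom_simple hU; set c := \dim (uhom mU mU) => c12 E.
exists c; split=> //.
have U0 : (0 < \dim {:U})%N by rewrite lt0n; apply/eqP; case: hU.
have := congr1 (logn 2) E.
have c0 : (0 < c)%N by case/andP: c12.
clearbody c; rewrite !lognM ?expn_gt0 // lognX logn_prime // muln1 addnn.
move=> /(congr1 odd); rewrite odd_double oddD.
by case: c c12 c0 {E} => [|[|[|]]] //= _ _; case: odd.
Qed.

Variables (d : nat) (w : 'I_n -> 'End('cV[F]_d)) (b : 'I_n -> 'I_n -> F).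
Variables (BM : supermodule Wm (tensor U 'cV[F]_d)).
Hypothesis hBM : forall i u x,
  BM (t i) (tens u x) = \sum_k b i k *: tens (mU (e k) u) (w i x).
Variables (ClM : supermodule Hc (tensor Cl 'cV[F]_d)).
Hypothesis hClM : forall i a x, ClM (theta (t i)) (tens a x) =
  \sum_k b i k *: tens ('i *: (apar Cl a * e k)) (w i x).

Lemma dim_intertw_spin_tensor (Y : vectType F) (T : 'I_n -> 'End(Y)) :
  (2 ^ n * \dim (intertw T (fun i => BM (t i))))%N =
  (\dim {:U} * \dim (intertw T (fun i => ClM (theta (t i)))))%N.
Proof.
have ce := clifford_ops_smod mU eo ee eC.
have [r [rE cr]] := right_clifford_ops.
pose E i : 'End(U) := \sum_k b i k *: mU (e k).
pose E' i : 'End(Cl) := \sum_k b i k *: r k.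
have EE i u : E i u = \sum_k b i k *: mU (e k) u.
  by rewrite sum_lfunE; apply: eq_bigr => k _; rewrite lfunS.
have EE' i a : E' i a = \sum_k b i k *: r k a.
  by rewrite sum_lfunE; apply: eq_bigr => k _; rewrite lfunS.
have := dim_intertw_clifford_tensor w T ce cr EE EE'.
rewrite dim_clifford_algebra.
have -> : intertw T (fun i => tmap (E i) (w i)) = intertw T (fun i => BM (t i)).
  congr (intertw T _); apply/boolp.funext => i; apply/lfunP.
  apply: tensor_lfun_ext => u x; rewrite tmapE hBM EE -tensrE lfun_sum.
  by apply: eq_bigr => k _; rewrite lfunZ tensrE.
have -> // : intertw T (fun i => tmap (E' i) (w i)) =
  intertw T (fun i => ClM (theta (t i))).
congr (intertw T _); apply/boolp.funext => i; apply/lfunP.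
apply: tensor_lfun_ext => u x; rewrite tmapE hClM EE' -tensrE lfun_sum.
by apply: eq_bigr => k _; rewrite lfunZ tensrE rE.
Qed.

Variables (X : vectType F) (chi : supermodule Hc X).
Variables (Y : vectType F) (chim : supermodule Wm Y).

Lemma dim_shom_frakG Z (sZ : is_frakG (l := j) theta (mU := mU) (X := chi) Z) :
  siso chim Z -> \dim (shom chim BM) = ((odd n).+1 * \dim (shom chi ClM))%N.
Proof.
move=> iso; rewrite !dim_shom (dim_uhom_siso BM iso) tgen.
have [c [uu cE]] := dim_simple_clifford; rewrite -cE.
have ce := clifford_ops_smod mU eo ee eC.
have memG (f : 'Hom(U, X)) : f \in shom mU (pullback j chi) <->
    forall k u, f (mU (e k) u) = chi (j (e k)) (smpar chi (f (smpar mU u))).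
  apply: (@mem_shom_gen _ _ _ _ mU (pullback j chi) _ e eo) => g ge.
  by rewrite egen; apply/mem_intertw.
have h1 := @dim_intertw_clifford_hom _ _ _ _ _ _ _ _ _ _
  (fun i => chi (theta (t i))) (fun i => BM (t i)) _ (fun i => Z (t i))
  ce (clifford_ops_j chi) (theta_cl chi) (theta_par chi) memG
  (fun i f u => proj2 sZ (t i) f u).
have h2 := dim_intertw_spin_tensor (fun i => chi (theta (t i))).
have h3 := dim_uhom_hecke_clifford chi ClM.
have N0 : (0 < 2 ^ n)%N by rewrite expn_gt0.
apply/eqP; rewrite -(eqn_pmul2l N0) -(eqn_pmul2l N0); apply/eqP.
rewrite h1 mulnCA h2 -h3 mulnA uu; set N := (2 ^ n)%N.
by rewrite -!mulnA [(c * (N * _))%N]mulnCA.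
Qed.

Lemma dim_shom_frakF Z (sZ : is_frakF j theta mU chim Z) :
  siso Z chi -> \dim (shom chim BM) = \dim (shom chi ClM).
Proof.
move=> iso; rewrite !dim_shom -(dim_uhom_siso ClM iso) tgen.
have h3 := dim_uhom_hecke_clifford Z ClM.
have ZE : (fun i => Z (theta (t i))) = (fun i => tmap (smpar mU) (chim (t i))).
  apply/boolp.funext => i; apply/lfunP; case: sZ => _ _ Zr.
  apply: tensor_lfun_ext => u y; rewrite tmapE.
  have [u0 [u1 [P0 P1 ->]]] := mpar_split mU u.
  rewrite !(lfunD, tensDl) (smparE P0) (smparE P1) !tensZl.
  by rewrite (Zr _ _ _ _ _ (ho i) P0) (Zr _ _ _ _ _ (ho i) P1).
rewrite ZE (dim_intertw_outer_tensor _ (smparK mU) (smparK chim)) in h3; last first.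
  by move=> i y; rewrite (mact_smpar chim y (ho i)) scaleN1r.
have := dim_intertw_spin_tensor (fun i => chim (t i)); rewrite -h3.
by move/eqP; rewrite eqn_pmul2l ?expn_gt0 // => /eqP.
Qed.

Lemma dim_shom_morita :
  morita_corresponds n j theta mU chi chim ->
  [/\ ~~ odd n -> \dim (shom chim BM) = \dim (shom chi ClM),
      odd n -> type_M chi -> \dim (shom chim BM) = (2 * \dim (shom chi ClM))%N &
      odd n -> type_Q chi -> \dim (shom chim BM) = \dim (shom chi ClM)].
Proof.
case=> _ hG hF; split=> [ne|no tM|no tQ].
- have [Z sZ iso] := hG (or_introl ne).
  by rewrite (dim_shom_frakG sZ iso) (negPf ne) mul1n.
- have [Z sZ iso] := hG (or_intror tM).
  by rewrite (dim_shom_frakG sZ iso) no.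
have [_ [Z sZ iso]] := hF no tQ; exact: dim_shom_frakF sZ iso.
Qed.

End Assembly.

(** * Reflections and the Clifford algebra of the reflection representation *)

Section Roots.
Variables (R : rcfType) (n : nat).
Implicit Types a v : 'cV[R]_n.

Lemma dotE (F : fieldType) (v w : 'cV[F]_n) : dot v w = \sum_k v k 0 * w k 0.
Proof. by rewrite /dot mxE; apply: eq_bigr => k _; rewrite mxE. Qed.

Lemma dot_scale (F : fieldType) (c c' : F) (v w : 'cV[F]_n) :
  dot (c *: v) (c' *: w) = c * c' * dot v w.
Proof.
rewrite !dotE mulr_sumr; apply: eq_bigr => k _.
by rewrite !mxE mulrACA.
Qed.

Lemma dot_gt0 v : v != 0 -> 0 < dot v v.
Proof.
move=> v0; rewrite lt_def dotE sumr_ge0 ?andbT => [|k _]; last first.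
  by rewrite -expr2 sqr_ge0.
apply: contraNneq v0 => /eqP; rewrite psumr_eq0 => [/allP h|k _]; last first.
  by rewrite -expr2 sqr_ge0.
apply/eqP/colP => k; rewrite mxE.
by have := h k (mem_index_enum _); rewrite mulf_eq0 orbb => /eqP.
Qed.

Definition unit_root a : 'cV[R]_n := (Num.sqrt (dot a a))^-1 *: a.

Lemma dot_unit_root a : a != 0 -> dot (unit_root a) (unit_root a) = 1.
Proof.
move=> /dot_gt0 a0; rewrite dot_scale -invfM -expr2 sqr_sqrtr ?mulVf ?gt_eqF //.
exact: ltW.
Qed.

Lemma reflection_unit_root a v : a != 0 ->
  reflection a v = v - (2 * dot (unit_root a) v) *: unit_root a.
Proof.
move=> /dot_gt0 a0; rewrite /reflection /unit_root; set c := (Num.sqrt _)^-1.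
have cc : c * c = (dot a a)^-1.
  by rewrite -invfM -expr2 sqr_sqrtr // ltW.
have -> : dot (c *: a) v = c * dot a v.
  by rewrite -[v in LHS]scale1r dot_scale mulr1.
by rewrite scalerA -cc !mulrA (mulrAC 2 c).
Qed.

Lemma mx_ext (F : fieldType) m (A B : 'M[F]_(m, n)) :
  (forall v : 'cV_n, A *m v = B *m v) -> A = B.
Proof.
move=> AB; apply/matrixP => p q; have := AB (delta_mx q 0).
by rewrite -!colE => /matrixP/(_ p 0); rewrite !mxE.
Qed.

(** The real matrix of a reflection is [1 - 2 u u^T], and this identity survives
    extension of scalars to complex vectors. *)
Lemma unit_root_reflection_mx (A : 'M[R]_n) a : a != 0 ->
  (forall v, A *m v = reflection a v) ->
  forall z : 'cV[R[i]]_n, let b := complexify (unit_root a) in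
    map_mx (real_complex R) A *m z = z - (2 * dot b z) *: b.
Proof.
move=> a0 Aa z b; pose u := unit_root a.
have mul1 (F : fieldType) (x y : 'cV[F]_n) : x *m (x^T *m y) = dot x y *: x.
  by apply/colP => k; rewrite !mxE big_ord1 mulrC; congr (_ * _).
have -> : A = 1%:M - 2 *: (u *m u^T).
  apply: mx_ext => v; rewrite Aa reflection_unit_root // mulmxBl mul1mx.
  by rewrite -scalemxAl -mulmxA mul1 [in RHS]scalerA.
rewrite (map_mxB (real_complex R)) map_mx1
  map_mxZ map_mxM -map_trmx mulmxBl mul1mx.
by rewrite -scalemxAl -mulmxA mul1 scalerA rmorph_nat.
Qed.

Lemma dot_complexify a v : dot (complexify a) (complexify v) = (dot a v)%:C%C.
Proof.
by rewrite !dotE rmorph_sum; apply: eq_bigr => k _; rewrite !mxE rmorphM.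
Qed.

End Roots.

Section CliffordAlgebra.
Variables (F : numFieldType) (n : nat) (Cl : superalgebra F).
Variables (iota : {linear 'cV[F]_n -> Cl}).
Hypothesis hCl : is_clifford (@dot F n) iota.

Definition cl_basis k : Cl := iota (delta_mx k 0).

Lemma iota_sum v : iota v = \sum_k v k 0 *: cl_basis k.
Proof.
rewrite [in LHS](matrix_sum_delta v) linear_sum; apply: eq_bigr => k _.
by rewrite big_ord1 linearZ.
Qed.

Lemma iota_sqr v : dot v v = 1 -> iota v * iota v = 1.
Proof.
case: hCl => _ h _ _ v1; have := h v v.
rewrite v1 mulr1 -mulr2n -scaler_nat => /(congr1 (fun x => 2^-1 *: x)).
by rewrite !scalerA mulVf ?pnatr_eq0 // !scale1r.
Qed.

Lemma iota_anti v w : iota v * iota w = (2 * dot v w)%:A - iota w * iota v.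
Proof. by case: hCl => _ h _ _; rewrite -h addrK. Qed.

Lemma dot_delta (k l : 'I_n) :
  dot (delta_mx k 0 : 'cV[F]_n) (delta_mx l 0) = (k == l)%:R.
Proof.
rewrite dotE (bigD1 k) //= big1 => [|m mk]; last first.
  by rewrite !mxE eqxx (negPf mk) mul0r.
by rewrite !mxE !eqxx !andbT mul1r addr0.
Qed.

Lemma cl_basis_odd k : cl_basis k \in spar Cl true.
Proof. by case: hCl => io _ _ _; apply: io. Qed.

Lemma cl_basisK k : cl_basis k * cl_basis k = 1.
Proof. by apply: iota_sqr; rewrite dot_delta eqxx. Qed.

Lemma cl_basisC k l : k != l -> cl_basis k * cl_basis l = - (cl_basis l * cl_basis k).
Proof.
by move=> kl; rewrite iota_anti dot_delta (negPf kl) mulr0 scale0r sub0r.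
Qed.

Lemma cl_basis_gen : agenv <<[seq cl_basis k | k : 'I_n]>>%VS = fullv.
Proof.
apply/eqP; rewrite eqEsubv subvf /=; case: hCl => _ _ <- _; apply: agenvS.
apply/subvP => _ /memv_imgP[v _ ->]; rewrite lfunE iota_sum.
apply: memv_suml => k _; apply: memvZ; apply: memv_span; exact: image_f.
Qed.

(** An algebra automorphism extending the reflection in a unit vector [b] is
    [a |-> (-1)^|a| b a b]: both sides are multiplicative in the twisted sense,
    and they agree on vectors, where [b (v - 2 (b, v) b) = - v b]. *)
Lemma reflection_conj (g : salg_hom Cl Cl) (A : 'M[F]_n) (b : 'cV[F]_n) :
  dot b b = 1 -> (forall v, g (iota v) = iota (A *m v)) ->
  (forall v, A *m v = v - (2 * dot b v) *: b) ->
  forall a, iota b * g a = apar Cl a * iota b.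
Proof.
move=> bb gA Ab.
pose P (a : Cl) := iota b * g a = apar Cl a * iota b.
have memP : forall a, a \in vspan P <-> P a.
  apply: (mem_vspan_closed (P := P)) => [|c x y Px Py].
    by rewrite /P !linear0 mulr0 mul0r.
  by rewrite /P linearP mulrDr -scalerAr Px Py lfunD lfunZ mulrDl scalerAl.
have sub : (agenv (limg (linfun iota)) <= vspan P)%VS.
  apply: agenv_sub_modl.
    apply/subvP => _ /vlineP[c ->]; apply: memvZ; apply/memP.
    by rewrite /P rmorph1 (aparE (spar1 Cl)) scale1r mulr1 mul1r.
  apply/prodvP => _ x /memv_imgP[v _ ->] /memP Px; apply/memP.
  have Pv : P (iota v).
    rewrite /P gA Ab linearB linearZ /= mulrBr -scalerAr iota_sqr // iota_anti.
    have vo : iota v \in spar Cl true by case: hCl.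
    by rewrite (aparE vo) scaleN1r mulNr addrAC subrr sub0r.
  by rewrite lfunE /P rmorphM aparM mulrA Pv -!mulrA Px.
move=> a; apply/memP; apply: (subvP sub).
by case: hCl => _ _ -> _; rewrite memvf.
Qed.

End CliffordAlgebra.

Theorem proposition3p8 (R : realType) (n : nat)
    (* the irreducible Weyl group W and its reflection representation V *)
    (Phi : seq 'cV[R]_n) (alpha : 'I_n -> 'cV[R]_n)
    (hPhi : root_system Phi) (hirr : irreducible_roots Phi)
    (halpha : simple_roots Phi alpha)
    (W : finGroupType) (s : 'I_n -> W)
    (rV : mx_representation R [set: W] n) (hW : weyl_group alpha s rV)
    (hV : irreducible_rep (complex_repr rV))
    (* the Clifford superalgebra of V and the action of W on it *)
    (Cl : superalgebra R[i]) (iota : {linear 'cV[R[i]]_n -> Cl})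
    (hCl : is_clifford (@dot R[i] n) iota)
    (act : W -> salg_hom Cl Cl)
    (hact : forall w v, act w (iota v) = iota (complex_repr rV w *m v))
    (* the Hecke-Clifford superalgebra *)
    (Hc : superalgebra R[i]) (j : salg_hom Cl Hc) (k : W -> Hc)
    (hHc : is_smash act j k)
    (* the spin Weyl group algebra *)
    (Wm : superalgebra R[i]) (t : 'I_n -> Wm)
    (hWm : is_spin_algebra (coxeter_mx s) t)
    (* the isomorphism of Hc with the super tensor product of Cl and Wm *)
    (theta : salg_hom Wm Hc) (htheta : is_super_tensor j theta)
    (hs : forall i : 'I_n,
       k (s i) = (- ('i : R[i])) *: (j (beta alpha iota i) * theta (t i)))
    (* the simple Clifford module U and the basic spin module, its pullback *)
    (U : vectType R[i]) (mU : supermodule Cl U) (hU : simple_smod mU)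
    (phi : salg_hom Wm Cl) (hphi : forall i, phi (t i) = beta alpha iota i)
    (* the W-module M and the two induced modules *)
    (d : nat) (rM : mx_representation R[i] [set: W] d)
    (BM : supermodule Wm (tensor U 'cV[R[i]]_d))
    (hBM : is_spin_tensor s t (pullback phi mU) rM BM)
    (ClM : supermodule Hc (tensor Cl 'cV[R[i]]_d))
    (hClM : is_clifford_tensor act j k rM ClM)
    (* the corresponding simple modules *)
    (X : vectType R[i]) (chi : supermodule Hc X) (hchi : simple_smod chi)
    (Y : vectType R[i]) (chim : supermodule Wm Y)
    (hchim : morita_corresponds n j theta mU chi chim) :
  let m_chi := \dim (shom chi ClM) in
  let m_chim := \dim (shom chim BM) in
  [/\ ~~ odd n -> m_chim = m_chi,
      odd n -> type_M chi -> m_chim = (2 * m_chi)%N &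
      odd n -> type_Q chi -> m_chim = m_chi].
Proof.
have a0 i : alpha i != 0.
  by case: hPhi => -[P0 _] _ _ _; case: halpha => aP _ _;
    apply: contraNneq P0 => <-.
pose b i : 'cV[R[i]]_n := complexify (unit_root (alpha i)).
have bb i : dot (b i) (b i) = 1 by rewrite dot_complexify dot_unit_root.
have betaE i : beta alpha iota i = iota (b i) by [].
have sE i z : complex_repr rV (s i) *m z = z - (2 * dot (b i) z) *: b i.
  by case: hW => _ _ h; apply: (unit_root_reflection_mx (a0 i) (h i)).
have conj i a : iota (b i) * act (s i) a = apar Cl a * iota (b i).
  exact: (reflection_conj hCl (bb i) (hact (s i)) (sE i)).
(* solve the formula for [k (s i)] for [theta (t i)], using [beta_i ^ 2 = 1] *)
have thetaE i : theta (t i) = 'i *: (j (iota (b i)) * k (s i)).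
  rewrite hs betaE -scalerAr scalerA mulrN -expr2 sqrCi opprK scale1r mulrA.
  by rewrite -rmorphM iota_sqr // rmorph1 mul1r.
have [w wE] : exists w : 'I_n -> 'End('cV[R[i]]_d), forall i x, w i x = rM (s i) *m x.
  exists (fun i => linfun (mulmx (rM (s i)))) => i x; exact: lfunE.
have [to _ tgen _] := hWm.
apply: (@dim_shom_morita _ n Cl Hc Wm (cl_basis iota) t (cl_basis_odd hCl)
  (cl_basisK hCl) (cl_basisC hCl) _ to _ j theta htheta U mU hU d w
  (fun i l => b i l 0) BM _ ClM _ X chi Y chim hchim).
- by move=> M N mM mN; apply: uhom_span_gen; exact: cl_basis_gen.
- by move=> M N mM mN; apply: uhom_span_gen.
- move=> i u x; case: hBM => _ ->; rewrite -wE /= hphi betaE iota_sum.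
  rewrite linear_sum sum_lfunE -tensrE lfun_sum; apply: eq_bigr => l _ /=.
  by rewrite mact_scale lfunZ tensrE.
move=> i a x; case: hClM => _ hj hk; rewrite thetaE mact_scale mactM hk hj conj.
rewrite iota_sum mulr_sumr -tensrE -lfunZ scaler_sumr lfun_sum wE.
apply: eq_bigr => l _; rewrite -scalerAr scalerA mulrC -scalerA lfunZ.
by rewrite tensrE.
Qed.
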